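(* Let $X$ be a measurable space and $\mathcal{H}$ a complex separable Hilbert space. An atomic normalized POVM $\mu:\mathcal{O}(X)\to\mathcal{B}(\mathcal{H})$ is a $C^*$-extreme point in $\mathcal{P}_{\mathcal{H}}(X)$ if and only if $\mu$ is a spectral measure. In particular, if $X$ is a countable measurable space, then any $C^*$-extreme point of $\mathcal{P}_{\mathcal{H}}(X)$ is a spectral measure.
   Context: A measurable space is a nonempty set $X$ with a $\sigma$-algebra $\mathcal{O}(X)$ of subsets; all singletons are assumed measurable. $\mathcal{B}(\mathcal{H})$ denotes the bounded operators on $\mathcal{H}$; the inner product is linear in the second variable; a projection is a self-adjoint idempotent. A positive operator valued measure (POVM) on $X$ with values in $\mathcal{B}(\mathcal{H})$ is a map $\mu:\mathcal{O}(X)\to\mathcal{B}(\mathcal{H})$ with $\mu(A)\ge 0$ for all $A$ and such that for all $h,k\in\mathcal{H}$ the map $A\mapsto\langle h,\mu(A)k\rangle$ is a complex measure. It is normalized if $\mu(X)=I_{\mathcal{H}}$, and it is a spectral measure if it is normalized and every $\mu(A)$ is a projection. $\mathcal{P}_{\mathcal{H}}(X)$ is the set of all normalized POVMs on $X$ with values in $\mathcal{B}(\mathcal{H})$. A set $A\in\mathcal{O}(X)$ is an atom for $\mu$ if $\mu(A)\ne 0$ and for every measurable $B\subseteq A$ either $\mu(B)=0$ or $\mu(B)=\mu(A)$. $\mu$ is atomic if every $A\in\mathcal{O}(X)$ with $\mu(A)\neq 0$ contains an atom for $\mu$. A normalized POVM $\mu$ is a $C^*$-extreme point in $\mathcal{P}_{\mathcal{H}}(X)$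 if, whenever $\mu(\cdot)=\sum_{i=1}^n T_i^*\mu_i(\cdot)T_i$ with $\mu_i\in\mathcal{P}_{\mathcal{H}}(X)$ and invertible $T_i\in\mathcal{B}(\mathcal{H})$ satisfying $\sum_{i=1}^n T_i^*T_i=I_{\mathcal{H}}$, there are unitaries $U_i\in\mathcal{B}(\mathcal{H})$ such that $\mu_i(\cdot)=U_i^*\mu(\cdot)U_i$ for $1\le i\le n$. *)

(* Defs.v *)
From HB Require Import structures.
From mathcomp Require Import all_boot all_order all_algebra sesquilinear complex.
From mathcomp Require Import all_classical all_reals all_analysis.
From mathcomp Require Import ring lra.

Set Implicit Arguments.
Unset Strict Implicit.
Unset Printing Implicit Defensive.

Import Order.TTheory GRing.Theory Num.Theory.
Import numFieldNormedType.Exports.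

Local Open Scope classical_set_scope.
Local Open Scope complex_scope.
Local Open Scope ring_scope.

HB.mixin Record CompleteNormedModule_isHilbert (R : realType) H
    & CompleteNormedModule R[i] H := {
  hdot : {dot H for (@Num.conj R[i])} ;
  hdot_norm : forall x : H, hdot x x = `|x| ^+ 2 }.

#[short(type="hilbertType")]
HB.structure Definition Hilbert (R : realType) :=
  {H of CompleteNormedModule R[i] H & CompleteNormedModule_isHilbert R H}.

(* [hdot] is linear in its first variable, as [{dot _ for _}] requires; the
   inner product swaps the arguments so as to be linear in the second one. *)
Definition inner (R : realType) (H : hilbertType R) (h k : H) : R[i] :=
  hdot k h.

Section InnerProductTheory.
Context {R : realType} {H : hilbertType R}.
Implicit Types (h k x y : H) (T : H -> H).

Lemma innerDr h x y : inner h (x + y) = inner h x + inner h y.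
Proof. exact: linearDl. Qed.

Lemma innerZr h a x : inner h (a *: x) = a * inner h x.
Proof. exact: linearZl_LR. Qed.

Lemma inner_conj h k : inner h k = Num.conj (inner k h).
Proof. by rewrite /inner hermitian_subproof expr0 mul1r. Qed.

Lemma innerDl h x y : inner (x + y) h = inner x h + inner y h.
Proof. by rewrite !(inner_conj _ h) innerDr rmorphD. Qed.

Lemma innerZl h a x : inner (a *: x) h = Num.conj a * inner x h.
Proof. by rewrite !(inner_conj _ h) innerZr rmorphM. Qed.

Lemma inner_norm x : inner x x = `|x| ^+ 2.
Proof. exact: hdot_norm. Qed.

(* Real parts of the inner product and of the [R[i]]-valued norm. *)
Let B x y : R := complex.Re (inner x y).
Let N x : R := complex.Re `|x|.

Let normN x : `|x| = (N x)%:C.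
Proof. by rewrite RRe_real// normr_real. Qed.

Let N_ge0 x : 0 <= N x.
Proof. by rewrite -ler0c -normN. Qed.

Let BDr h x y : B h (x + y) = B h x + B h y.
Proof. by rewrite /B innerDr raddfD. Qed.

Let BZr h (t : R) x : B h (t%:C *: x) = t * B h x.
Proof. rewrite /B innerZr; case: (inner h x) => a b /=.
by rewrite mul0r subr0. Qed.

Let BC x y : B x y = B y x.
Proof. by rewrite /B inner_conj; case: (inner y x). Qed.

Let BN x : B x x = N x ^+ 2.
Proof. by rewrite /B inner_norm normN -rmorphXn. Qed.

Let quad (e D a : R) :
  0 <= a -> (forall t, 0 <= e + 2 * t * D + t ^+ 2 * a) -> D ^+ 2 <= e * a.
Proof.
move=> a0 h; have e0 : 0 <= e by have := h 0; rewrite mulr0 mul0r expr0n /= mul0r !addr0.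
have [a_0|aN0] := eqVneq a 0.
  rewrite a_0 mulr0; rewrite a_0 in h.
  have [->|D0] := eqVneq D 0; first by rewrite expr0n.
  have := h (- (e + 1) / D); set t := _ / D.
  have -> : 2 * t * D = - 2 * (e + 1) by rewrite /t -mulrA divfK// mulrN mulNr.
  rewrite mulr0 addr0; lra.
have a1 : 0 < a by rewrite lt_def aN0.
have := h (- (D / a)).
have -> : e + 2 * - (D / a) * D + (- (D / a)) ^+ 2 * a = (e * a - D ^+ 2) / a by field.
by rewrite pmulr_lge0 ?invr_gt0// subr_ge0.
Qed.

Let NDZ x (t : R) k :
  N (x + t%:C *: k) ^+ 2 = N x ^+ 2 + 2 * t * B x k + t ^+ 2 * N k ^+ 2.
Proof.
rewrite -!BN BDr BZr !(BC (x + _)) !BDr !BZr (BC k x); ring.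
Qed.

Let cauchy_schwarz x k : B x k ^+ 2 <= (N x * N k) ^+ 2.
Proof.
rewrite exprMn; apply: quad; first exact: sqr_ge0.
by move=> t; rewrite -NDZ sqr_ge0.
Qed.

Lemma inner_le h k : `|inner h k| <= `|h| * `|k|.
Proof.
set z := inner h k; have [->|z0] := eqVneq z 0; first by rewrite normr0 mulr_ge0.
have [r zr] : exists r : R, `|z| = r%:C.
  by exists (complex.Re `|z|); rewrite RRe_real// normr_real.
have r0 : 0 < r by rewrite -ltcR -zr normr_gt0.
have NzE : N (Num.conj z *: k) = r * N k.
  by rewrite /N normrZ norm_conjC zr; case: `|k| => a b /=; rewrite mul0r subr0.
have BzE : B h (Num.conj z *: k) = r ^+ 2.
  by rewrite /B innerZr -/z mulrC -normCK zr -rmorphXn.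
have := cauchy_schwarz h (Num.conj z *: k); rewrite NzE BzE.
rewrite ler_pXn2r ?nnegrE ?exprn_ge0 ?mulr_ge0 ?(ltW r0)//.
rewrite mulrCA expr2 ler_pM2l// => rN.
rewrite zr !normN -[leRHS](rmorphM (real_complex R)) lecR; exact: rN.
Qed.

Lemma riesz (f : H -> R[i]) (M : R[i]) :
    linear_for *%R f -> (forall h, `|f h| <= M * `|h|) ->
  exists v, forall h, f h = inner v h.
Proof.
move=> fL fM.
have fD x y : f (x + y) = f x + f y by have := fL 1 x y; rewrite scale1r mul1r.
have f0 : f 0 = 0 by have := fD 0 0; rewrite addr0 => /eqP; rewrite -subr_eq0 opprD addNKr oppr_eq0 => /eqP.
have fZ a x : f (a *: x) = a * f x by have := fL a x 0; rewrite addr0 f0 addr0.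
pose F x : R := complex.Re (f x).
have FDZ x (t : R) k : F (x + t%:C *: k) = F x + t * F k.
  by rewrite /F fD fZ; case: (f x) => a b; case: (f k) => c d /=; rewrite mul0r subr0.
pose m : R := complex.Re `|M|.
have Fm x : `|F x| <= m * N x.
  rewrite -lecR; apply: le_trans (normc_ge_Re _) _.
  apply: le_trans (fM x) _; apply: le_trans (real_ler_norm _) _.
    by apply: (@ger0_real _ _ (le_trans (normr_ge0 _) (fM x))).
  by rewrite normrM normr_id normN /m rmorphM/= RRe_real// normr_real.
pose J x := N x ^+ 2 - 2 * F x.
have JDZ x t k : J (x + t%:C *: k) = J x + 2 * t * (B x k - F k) + t ^+ 2 * N k ^+ 2.
  by rewrite /J NDZ FDZ; ring.
have Jlb x : - m ^+ 2 <= J x.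
  rewrite /J; have := Fm x; rewrite ler_norml => /andP[_ ?].
  have := sqr_ge0 (N x - m); nra.
have infJ : has_inf (range J).
  split; first by exists (J 0), 0.
  by exists (- m ^+ 2) => _ [x _ <-].
set I := inf (range J).
have IJ x : I <= J x by apply: ge_inf; [exact: infJ.2|exists x].
have /choice[u uJ] : forall n : nat, exists x, J x < I + n.+1%:R^-1.
  move=> n; have [|_ [x _ <-] ?] := @inf_adherent _ (range J) n.+1%:R^-1 _ infJ.
    by rewrite invr_gt0.
  by exists x.
have uN n p : (n <= p)%N -> N (u n - u p) ^+ 2 <= 4 * n.+1%:R^-1.
  move=> np.
  have e1 := uJ n; have e2 := uJ p.
  have e3 : p.+1%:R^-1 <= n.+1%:R^-1 :> R by rewrite lef_pV2 ?posrE// ler_nat.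
  have := IJ (u p + (2^-1)%:C *: (u n - u p)).
  have : J (u n) = J (u p + (1 : R)%:C *: (u n - u p)).
    by rewrite scale1r addrC subrK.
  rewrite !JDZ; set D := B _ _ - _; set q := N _ ^+ 2.
  have -> : 2 * 2^-1 * D = D by field.
  have -> : (2^-1) ^+ 2 * q = q / 4 by field.
  rewrite mulr1 expr1n mul1r; move: (J _) (J _) (n.+1%:R^-1) (p.+1%:R^-1) e1 e2 e3.
  by move=> ? ? ? ? ? ? ? ? ?; lra.
have small (e : R) : 0 < e -> exists n : nat, forall p, (n <= p)%N -> p.+1%:R^-1 < e.
  move=> e0; have [n ne] := near_infty_natSinv_lt (PosNum e0).
  by move=> nE; exists n => p np; apply: nE.
have uC : cauchy (u @ \oo).
  apply: cauchy_exP => e e0.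
  have [r er] : exists r : R, e = r%:C.
    by exists (complex.Re e); rewrite RRe_real// gtr0_real.
  rewrite er ltcR in e0 *.
  have [n nr] := small (r ^+ 2 / 4) ltac:(by rewrite divr_gt0 ?exprn_gt0).
  exists (u n); exists n => // p /= np.
  rewrite -ball_normE /= normN ltcR.
  rewrite -(@ltr_pXn2r _ 2)// ?nnegrE ?N_ge0 ?ltW//.
  apply: le_lt_trans (uN _ _ np) _; by rewrite mulrC -ltr_pdivlMr//; exact: nr.
have [v uv] : exists v : H, u @ \oo --> v by exists (lim (u @ \oo)); exact: cauchy_cvg uC.
have ReE k : B v k = F k.
  apply/eqP; rewrite -subr_eq0; apply/negPn/negP => D0.
  set D := B v k - F k in D0.
  pose e := `|D| / (4 * (N k + 1)).
  have k1 : 0 < 4 * (N k + 1) by have := N_ge0 k; lra.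
  have e0 : 0 < e by rewrite divr_gt0 ?normr_gt0.
  have De : `|D| = e * (4 * (N k + 1)) by rewrite /e divfK// gt_eqF.
  have [n1 n1e] := small (e ^+ 2) ltac:(by rewrite exprn_gt0).
  have /cvgrPdist_lt /(_ e%:C) := uv.
  rewrite ltcR => /(_ e0)[n2 _ n2e].
  pose n := maxn n1 n2.
  have a1 := n1e n (leq_maxl _ _).
  have := n2e n (leq_maxr _ _); rewrite /= normN ltcR => a2.
  set w := v - u n in a2.
  have DE : D = (B (u n) k - F k) + B w k.
    rewrite /D; have -> : B v k = B (u n) k + B w k by rewrite !(BC _ k) -BDr /w addrC subrK.
    by rewrite addrAC.
  have eN : 0 <= e * N k by rewrite mulr_ge0// ltW.
  have b1 : `|B w k| <= e * N k.
    rewrite -(@ler_pXn2r _ 2) ?nnegrE ?normr_ge0//.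
    rewrite real_normK ?num_real//.
    apply: le_trans (cauchy_schwarz _ _) _.
    apply: lerXn2r; rewrite ?nnegrE//; first by rewrite mulr_ge0.
    by apply: ler_wpM2r => //; exact: ltW.
  have b2 : `|B (u n) k - F k| <= e * N k.
    rewrite -(@ler_pXn2r _ 2) ?nnegrE ?normr_ge0//.
    rewrite real_normK ?num_real// exprMn; apply: quad; first exact: sqr_ge0.
    move=> t; have := IJ (u n + t%:C *: k); rewrite JDZ.
    have := lt_trans (uJ n) (ler_ltD (lexx I) a1).
    by move: (J _) (2 * t * _) (t ^+ 2 * _) (e ^+ 2) => ? ? ? ?; lra.
  have := ler_normD (B (u n) k - F k) (B w k); rewrite -DE De.
  have := N_ge0 k; nra.
exists v => h; have := ReE h; have := ReE ('i *: h).
rewrite /B /F innerZr fZ; case: (inner v h) => a b; case: (f h) => c d /=.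
by rewrite !mul0r !mul1r !sub0r => /oppr_inj -> ->.
Qed.

End InnerProductTheory.

Section Operators.
Context {R : realType} {H : hilbertType R}.
Implicit Types (P S T U : H -> H).

Definition bounded_op T :=
  linear T /\ exists M : R, forall h, `|T h| <= M%:C * `|h|.

Definition is_adjoint T S := forall h k, inner h (T k) = inner (S h) k.

(* Meaningful only for bounded operators, whose adjoint exists and is unique by
   [adjP] and [adj_uniq]. *)
Definition adj T : H -> H := xget 0 (is_adjoint T).

Lemma inner_inj (v w : H) : (forall h, inner v h = inner w h) -> v = w.
Proof.
move=> vw; apply/eqP; rewrite -subr_eq0 -normr_eq0 -sqrf_eq0 -inner_norm.
by rewrite -scaleN1r innerDl innerZl vw rmorphN rmorph1 mulN1r subrr.
Qed.

Lemma adj_uniq T S : is_adjoint T S -> adj T = S.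
Proof.
move=> TS; have := xgetI 0 TS; rewrite -/(adj T) => TadjT.
by apply/funext => h; apply: inner_inj => k; rewrite -TadjT TS.
Qed.

Lemma adjP T : bounded_op T -> is_adjoint T (adj T).
Proof.
move=> [TL [M TM]].
have /choice[S TS] : forall h, exists v, forall k, inner h (T k) = inner v k.
  move=> h; apply: (@riesz _ _ _ (`|h| * M%:C)) => [a x y|k].
    by rewrite TL innerDr innerZr.
  apply: le_trans (inner_le _ _) _.
  by rewrite -mulrA; apply: ler_wpM2l.
by rewrite (adj_uniq TS).
Qed.

Lemma bounded_adj T : bounded_op T -> bounded_op (adj T).
Proof.
move=> Tb; have TA := adjP Tb; have [_ [M TM]] := Tb; split=> [a x y|].
  apply: inner_inj => k.
  by rewrite -TA !innerDl !innerZl !TA.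
exists M => h; have [->|Th0] := eqVneq (adj T h) 0.
  by rewrite normr0; exact: le_trans (TM h).
rewrite -(@ler_pM2l _ `|adj T h|) ?normr_gt0// -expr2 -inner_norm -TA.
have h0 : 0 <= inner h (T (adj T h)) by rewrite TA inner_norm exprn_ge0.
rewrite -(ger0_norm h0); apply: le_trans (inner_le _ _) _.
apply: le_trans (ler_wpM2l (normr_ge0 h) (TM _)) _.
by rewrite mulrC -mulrA [leRHS]mulrCA.
Qed.

(* On [R[i]], [0 <= z] means that [z] is real and nonnegative. *)
Definition positive_op T := forall h, 0 <= inner h (T h).

Definition projection P := adj P = P /\ P \o P = P.

Definition invertible_op T :=
  exists S, [/\ bounded_op S, S \o T = id & T \o S = id].

Definition unitary_op U :=
  [/\ bounded_op U, adj U \o U = id & U \o adj U = id].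

End Operators.

Definition separable_space (T : topologicalType) :=
  exists D : set T, countable D /\ dense D.

(* Convergence of the series is part of the definition; since it applies to every
   reordering of [F], it is absolute. All [F n] empty gives [nu set0 = 0]. *)
Definition complex_measure (R : realType) (d : measure_display)
    (X : measurableType d) (nu : set X -> R[i]) :=
  forall F : nat -> set X, (forall n, measurable (F n)) -> trivIset setT F ->
  (fun n => \sum_(0 <= i < n) nu (F i)) @ \oo --> (nu (\bigcup_n F n) : R[i]^o).

(* A map on the sigma-algebra is represented by a function on all subsets, of
   which only the values at measurable sets are ever considered. *)
Section POVM.
Context {R : realType} {d : measure_display} {X : measurableType d}
  {H : hilbertType R}.
Implicit Types (mu : set X -> H -> H) (A B : set X).

Definition povm mu :=
  [/\ forall A, measurable A -> bounded_op (mu A),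
      forall A, measurable A -> positive_op (mu A) &
      forall h k, complex_measure (fun A => inner h (mu A k))].

Definition normalized_povm mu := povm mu /\ mu setT = id.

Definition spectral_measure mu :=
  normalized_povm mu /\ forall A, measurable A -> projection (mu A).

Definition atom mu A :=
  [/\ measurable A, mu A <> 0 &
      forall B, measurable B -> B `<=` A -> mu B = 0 \/ mu B = mu A].

Definition atomic mu :=
  forall A, measurable A -> mu A <> 0 -> exists2 B, B `<=` A & atom mu B.

Definition cstar_extreme_point mu :=
  normalized_povm mu /\
  forall (n : nat) (nu : 'I_n -> set X -> H -> H) (T : 'I_n -> H -> H),
    (forall i, normalized_povm (nu i)) ->
    (forall i, bounded_op (T i) /\ invertible_op (T i)) ->
    \sum_i (adj (T i) \o T i) = id ->
    (forall A, measurable A -> mu A = \sum_i (adj (T i) \o nu i A \o T i)) ->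
    exists U : 'I_n -> H -> H, (forall i, unitary_op (U i)) /\
      forall i A, measurable A -> nu i A = adj (U i) \o mu A \o U i.

End POVM.

(* Main.v *)
Require Import Defs.
From HB Require Import structures.
From mathcomp Require Import all_boot all_order all_algebra complex.
From mathcomp Require Import all_classical all_reals all_analysis.
From mathcomp Require Import ring lra.

Set Implicit Arguments.
Unset Strict Implicit.
Unset Printing Implicit Defensive.

Import Order.TTheory GRing.Theory Num.Theory.
Import numFieldNormedType.Exports.

Local Open Scope classical_set_scope.
Local Open Scope complex_scope.
Local Open Scope ring_scope.

(** A spectral measure [mu] is extreme because, in a decomposition
    [mu = \sum_i T_i^* nu_i T_i], a vector killed by [mu A] makes each nonnegative
    summand [<T_i h, nu_i A (T_i h)>] vanish. Applied to [A] and its complement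
    this gives [nu_i A \o T_i = T_i \o mu A] ([spectral_intertwines]), and the
    unitary polar part of [T_i] still intertwines, since [T_i^* T_i] commutes with
    [mu A] ([intertwining_polar]).

    Conversely let [mu] be extreme and let [A] be an atom, [a = mu A]. Inside [A]
    the measure is [a] times a two-valued measure, so [a] may be split there as
    [D + (a - D)] with any [0 <= D <= a], the rest of [mu] being halved. If the
    total masses [S = D + (1 - a) / 2] and [1 - S] are invertible, this is a
    decomposition of [mu] into two normalized measures and extremality makes
    [S^(-1/2) D S^(-1/2)] unitarily equivalent to [a] ([atom_exchange]). Choose
    [D = P / 2] with [P] the spectral projection of [a] for [[1 - eta, 1]]. The
    operator obtained has spectrum in [{0}] together with
    [[1 / (1 + eta), 1]], hence so does [a]; as [eta] is arbitrary, [a] is a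
    projection ([atom_projection]).

    To pass from atoms to all sets, consider the measurable sets below which [mu]
    only takes projections as values. They are closed under countable unions
    ([projective_on_bigcup]). With a dense sequence of test vectors one finds such
    a set whose complement contains no atom of positive measure
    ([projective_on_exhaustion]); by atomicity that complement is null. On a
    countable space every measure is atomic, the atoms being points
    ([countable_atomic]).

    The operator theory needed is little: square roots, inverses and spectral
    projections of self-adjoint operators. They are obtained as limits of real
    polynomials in the operator. Square roots and inverses come from power series
    with nonnegative coefficients, which converge in norm; the spectral projection
    comes from the Newton-Schulz iteration for the sign function, which converges
    strongly because the squares of its iterates increase. *)

(** * The underlying real inner product *)

Section RealGeometry.
Context {R : realType} {H : hilbertType R}.
Implicit Types (h k u v x y : H) (s t : R).

(** The real part of the inner product already determines it, and on it
    inequalities and linear arithmetic take place in an ordered field. *)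
Definition rdot x y : R := complex.Re (inner x y).
Definition rnorm x : R := complex.Re `|x|.

Lemma normE x : `|x| = (rnorm x)%:C.
Proof. by rewrite RRe_real// normr_real. Qed.

Lemma rnorm_ge0 x : 0 <= rnorm x.
Proof. by rewrite -ler0c -normE. Qed.

Lemma rdotDr h x y : rdot h (x + y) = rdot h x + rdot h y.
Proof. by rewrite /rdot innerDr raddfD. Qed.

Lemma rdotC x y : rdot x y = rdot y x.
Proof. by rewrite /rdot inner_conj; case: (inner y x). Qed.

Lemma rdotDl h x y : rdot (x + y) h = rdot x h + rdot y h.
Proof. by rewrite !(rdotC _ h) rdotDr. Qed.

Lemma rdotZr h t x : rdot h (t%:C *: x) = t * rdot h x.
Proof. by rewrite /rdot innerZr; case: (inner h x) => a b /=; rewrite mul0r subr0. Qed.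

Lemma rdotZl h t x : rdot (t%:C *: x) h = t * rdot x h.
Proof. by rewrite !(rdotC _ h) rdotZr. Qed.

Lemma rdotNr h x : rdot h (- x) = - rdot h x.
Proof.
have -> : - x = (- 1)%:C *: x by rewrite rmorphN scaleN1r.
by rewrite rdotZr mulN1r.
Qed.

Lemma rdotNl h x : rdot (- x) h = - rdot x h.
Proof. by rewrite !(rdotC _ h) rdotNr. Qed.

Lemma rdot0r h : rdot h 0 = 0.
Proof. by have := rdotNr h 0; rewrite oppr0; lra. Qed.

Lemma rdot0l h : rdot 0 h = 0.
Proof. by rewrite rdotC rdot0r. Qed.

Definition rdotE := (rdotDr, rdotDl, rdotNr, rdotNl, rdotZr, rdotZl).

Lemma rdotxx x : rdot x x = rnorm x ^+ 2.
Proof. by rewrite /rdot inner_norm normE -rmorphXn. Qed.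

Lemma rdotxx_ge0 x : 0 <= rdot x x.
Proof. by rewrite rdotxx sqr_ge0. Qed.

Lemma Im_inner x y : complex.Im (inner x y) = rdot ('i *: x) y.
Proof.
by rewrite /rdot innerZl; case: (inner x y) => a b /=; rewrite mul0r mulN1r opprK add0r.
Qed.

Lemma rnorm0_eq0 x : rnorm x = 0 -> x = 0.
Proof. by move=> x0; apply/eqP; rewrite -normr_eq0 normE x0. Qed.

Lemma rdotxx_le0 x : rdot x x <= 0 -> x = 0.
Proof.
move=> x0; apply: rnorm0_eq0; apply/eqP; rewrite -sqrf_eq0 -rdotxx.
by rewrite eq_le x0 rdotxx_ge0.
Qed.

(** Linear identities between vectors are reduced to identities between real
    numbers, where they can be left to the ring solver. *)
Lemma rdot_inj u v : (forall k, rdot k u = rdot k v) -> u = v.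
Proof.
move=> uv; apply/eqP; rewrite -subr_eq0; apply/eqP; apply: rdotxx_le0.
by rewrite rdotDr rdotNr uv subrr.
Qed.

Lemma rnormD x y : rnorm (x + y) <= rnorm x + rnorm y.
Proof. by rewrite -lecR rmorphD/= -!normE ler_normD. Qed.

Lemma rnormZ t x : 0 <= t -> rnorm (t%:C *: x) = t * rnorm x.
Proof.
move=> t0; apply/eqP; rewrite -(@eqrXn2 _ 2)// ?rnorm_ge0 ?mulr_ge0 ?rnorm_ge0//.
by apply/eqP; rewrite -rdotxx rdotZl rdotZr rdotxx; ring.
Qed.

Lemma rnormN x : rnorm (- x) = rnorm x.
Proof. by rewrite /rnorm normrN. Qed.

Lemma rnorm0 : rnorm 0 = 0.
Proof. by rewrite /rnorm normr0. Qed.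

Lemma rnorm_dist x y : rnorm (x - y) = rnorm (y - x).
Proof. by rewrite -rnormN opprB. Qed.

Lemma rdot_le x y : rdot x y <= rnorm x * rnorm y.
Proof.
have h := le_trans (normc_ge_Re (inner x y)) (inner_le x y).
move: h; rewrite !normE -rmorphM lecR; exact/le_trans/ler_norm.
Qed.

(** The imaginary part of [inner x y] is the real part of [inner ('i *: x) y]. *)
Lemma rdot_eq_inner x y u v :
  (forall c, rdot (c *: x) y = rdot (c *: u) v) -> inner x y = inner u v.
Proof.
move=> e; apply/eqP; rewrite eq_complex !Im_inner e eqxx andbT.
by have := e 1; rewrite !scale1r /rdot => ->.
Qed.

End RealGeometry.

(** * Bounded operators *)
Section BoundedOperators.
Context {R : realType} {H : hilbertType R}.
Implicit Types (S T : H -> H) (t : R).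

Section Linear.
Variables (T : H -> H) (Tb : bounded_op T).

Lemma bopD x y : T (x + y) = T x + T y.
Proof. by have := Tb.1 1 x y; rewrite !scale1r. Qed.

Lemma bop0 : T 0 = 0.
Proof. by have := bopD 0 0; rewrite addr0 => /eqP; rewrite -subr_eq0 opprD addNKr oppr_eq0 => /eqP. Qed.

Lemma bopZ c x : T (c *: x) = c *: T x.
Proof. by have := Tb.1 c x 0; rewrite bop0 !addr0. Qed.

Lemma bopN x : T (- x) = - T x.
Proof. by rewrite -scaleN1r bopZ scaleN1r. Qed.

Lemma bop_bound : exists2 M, 0 < M & forall h, rnorm (T h) <= M * rnorm h.
Proof.
have [M TM] := Tb.2; exists (`|M| + 1) => [|h]; first by have := normr_ge0 M; lra.
have := TM h; rewrite !normE -rmorphM lecR => /le_trans; apply.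
apply: ler_wpM2r; first exact: rnorm_ge0.
have := ler_norm M; lra.
Qed.

End Linear.

Lemma bopP T M : (forall c x y, T (c *: x + y) = c *: T x + T y) ->
  (forall h, rnorm (T h) <= M * rnorm h) -> bounded_op T.
Proof.
move=> TL TM; split => //; exists M => h.
by rewrite !normE -rmorphM lecR.
Qed.

Lemma bounded_id : bounded_op (id : H -> H).
Proof. by apply: (@bopP _ 1) => // h; rewrite mul1r. Qed.

Lemma bounded_0 : bounded_op (fun _ : H => 0 : H).
Proof.
apply: (@bopP _ 0) => [c x y|h]; first by rewrite scaler0 addr0.
by rewrite rnorm0 mul0r.
Qed.

Lemma bounded_comp S T :
  bounded_op S -> bounded_op T -> bounded_op (fun h => S (T h)).
Proof.
move=> Sb Tb; have [M M0 SM] := bop_bound Sb; have [K K0 TK] := bop_bound Tb.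
apply: (@bopP _ (M * K)) => [c x y|h]; first by rewrite (bopD Tb) (bopZ Tb) (bopD Sb) (bopZ Sb).
by apply: le_trans (SM _) _; rewrite -mulrA ler_wpM2l// ltW.
Qed.

Lemma bounded_add S T :
  bounded_op S -> bounded_op T -> bounded_op (fun h => S h + T h).
Proof.
move=> Sb Tb; have [M M0 SM] := bop_bound Sb; have [K K0 TK] := bop_bound Tb.
apply: (@bopP _ (M + K)) => [c x y|h].
  by rewrite (bopD Tb) (bopZ Tb) (bopD Sb) (bopZ Sb) scalerDr addrACA.
by apply: le_trans (rnormD _ _) _; rewrite mulrDl lerD.
Qed.

Lemma bounded_scale c T : bounded_op T -> bounded_op (fun h => c *: T h).
Proof.
move=> Tb; have [M M0 TM] := bop_bound Tb; split=> [b x y|].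
  by rewrite (bopD Tb) (bopZ Tb) scalerDr !scalerA mulrC.
have cE : `|c| = (complex.Re `|c|)%:C by rewrite RRe_real// normr_real.
exists (complex.Re `|c| * M) => h; rewrite normrZ rmorphM/= -cE.
by rewrite -mulrA ler_wpM2l// !normE -rmorphM lecR.
Qed.

Lemma bounded_opp T : bounded_op T -> bounded_op (fun h => - T h).
Proof.
move=> Tb; have := bounded_scale (-1) Tb.
by congr bounded_op; apply/funext => h; rewrite scaleN1r.
Qed.

Lemma bounded_sub S T :
  bounded_op S -> bounded_op T -> bounded_op (fun h => S h - T h).
Proof. by move=> Sb Tb; apply: bounded_add => //; exact: bounded_opp. Qed.

Definition self_adjoint T := forall h k, rdot h (T k) = rdot (T h) k.

Lemma is_adjointP T S : bounded_op S ->
  (forall h k, rdot h (T k) = rdot (S h) k) -> is_adjoint T S.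
Proof.
by move=> Sb TS h k; apply: rdot_eq_inner => c; rewrite TS (bopZ Sb).
Qed.

Lemma is_adjoint_rdot S T h k :
  is_adjoint T S -> rdot h (T k) = rdot (S h) k.
Proof. by move=> TS; rewrite /rdot TS. Qed.

Lemma adj_self T : bounded_op T -> self_adjoint T -> adj T = T.
Proof. by move=> Tb Ts; apply/adj_uniq/is_adjointP. Qed.

(** Polarization: over the complex numbers, a form with real diagonal values is
    Hermitian. The polarization is done on [h + 'i k]. *)
Lemma positive_self_adjoint T :
  bounded_op T -> positive_op T -> self_adjoint T.
Proof.
move=> Tb Tp h k.
have Im0 u : rdot ('i *: u) (T u) = 0.
  by rewrite -Im_inner; have := Tp u; rewrite lecE /= => /andP[/eqP].
have ii u v : rdot ('i *: u) ('i *: v) = rdot u v.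
  rewrite /rdot innerZl innerZr.
  by case: (inner u v) => a b /=; ring.
have := Im0 (h + 'i *: k); rewrite scalerDr (bopD Tb) !rdotDl !rdotDr !Im0.
rewrite (bopZ Tb) ii scalerA -expr2 sqr_i scaleN1r rdotNl (rdotC k); lra.
Qed.

Lemma positive_opP T : bounded_op T ->
  positive_op T <-> self_adjoint T /\ forall h, 0 <= rdot h (T h).
Proof.
move=> Tb; split=> [Tp|[Ts Tp] h].
  split; first exact: positive_self_adjoint.
  by move=> h; have := Tp h; rewrite lecE => /andP[].
rewrite lecE Tp andbT/= Im_inner; apply/eqP.
have e : rdot ('i *: h) (T h) = - rdot h (T ('i *: h)).
  rewrite -[RHS]rdotNl (bopZ Tb) /rdot innerZl innerZr -scaleN1r innerZl.
  by case: (inner h (T h)) => a b /=; ring.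
by have := Ts ('i *: h) h; rewrite e (rdotC (T _)); lra.
Qed.

(** Cauchy-Schwarz for the semi-inner product defined by a positive operator,
    tested on [T h] itself. *)
Lemma positive_sqr_le T (r : R) h : bounded_op T -> self_adjoint T ->
    (forall h, 0 <= rdot h (T h)) -> (forall h, rdot h (T h) <= r * rdot h h) ->
  rdot (T h) (T h) <= r * rdot h (T h).
Proof.
move=> Tb Ts Tp Tr.
set A := rdot (T h) (T h); set b := rdot h (T h).
have q t : 0 <= b + 2 * t * A + t ^+ 2 * (r * A).
  apply: (@le_trans _ _ (b + 2 * t * A + t ^+ 2 * rdot (T h) (T (T h)))).
    have := Tp (h + t%:C *: T h); rewrite (bopD Tb) (bopZ Tb) !rdotE (Ts h (T h)).
    by rewrite -/A -/b; congr (_ <= _); ring.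
  by rewrite lerD2l ler_wpM2l ?sqr_ge0.
have A0 : 0 <= A by rewrite rdotxx_ge0.
have b0 : 0 <= b := Tp h.
have [Az|Az] := eqVneq A 0.
  have [r0|r0] := leP 0 r; first by rewrite Az mulr_ge0.
  have : h = 0 by apply: rdotxx_le0; have := Tp h; have := Tr h; have := rdotxx_ge0 h; nra.
  by move=> h0; rewrite /A /b h0 (bop0 Tb) !rdot0r mulr0.
have A1 : 0 < A by rewrite lt_def Az.
have r1 : 0 < r.
  rewrite ltNge; apply/negP => r0.
  (* A parameter at which the part of the quadratic that is affine in [t] is negative. *)
  have := q (- (b + 1) / A); set t := _ / A.
  have -> : 2 * t * A = - 2 * (b + 1) by rewrite /t -mulrA divfK// mulrN mulNr.
  have : t ^+ 2 * (r * A) <= 0 by rewrite mulr_ge0_le0 ?sqr_ge0// mulr_le0_ge0 // ltW.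
  lra.
(* The minimum of the quadratic. *)
have := q (- r^-1); have -> : (- r^-1) ^+ 2 * (r * A) = r^-1 * A by field; rewrite gt_eqF.
move=> q1; rewrite -ler_pdivrMl//; lra.
Qed.

Lemma positive_norm_le T (r : R) h : bounded_op T -> self_adjoint T -> 0 <= r ->
    (forall h, 0 <= rdot h (T h)) -> (forall h, rdot h (T h) <= r * rdot h h) ->
  rnorm (T h) <= r * rnorm h.
Proof.
move=> Tb Ts r0 Tp Tr.
rewrite -(@ler_pXn2r _ 2)// ?nnegrE ?mulr_ge0 ?rnorm_ge0//.
rewrite exprMn -!rdotxx; apply: le_trans (positive_sqr_le h Tb Ts Tp Tr) _.
by rewrite expr2 -mulrA ler_wpM2l.
Qed.

Lemma bounded_rdot T : bounded_op T ->
  exists2 M, 0 < M & forall h, rdot h (T h) <= M * rdot h h.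
Proof.
move=> Tb; have [M M0 TM] := bop_bound Tb; exists M => // h.
apply: le_trans (rdot_le _ _) _; rewrite rdotxx expr2 mulrCA.
by rewrite ler_wpM2l ?rnorm_ge0.
Qed.

(** A positive operator vanishes wherever its quadratic form does. This is how
    operator identities are extracted from inequalities throughout. *)
Lemma positive_null T h : bounded_op T -> self_adjoint T ->
  (forall h, 0 <= rdot h (T h)) -> rdot h (T h) <= 0 -> T h = 0.
Proof.
move=> Tb Ts Tp Th0; have [M M0 TM] := bounded_rdot Tb.
apply: rdotxx_le0; apply: le_trans (positive_sqr_le h Tb Ts Tp TM) _.
by rewrite pmulr_rle0.
Qed.

End BoundedOperators.

(** * Strong limits *)
Section Convergence.
Context {R : realType} {H : hilbertType R}.
Implicit Types (u v : nat -> H) (l k : H).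

Definition hcvg u l := forall e : R, 0 < e ->
  exists n0, forall n, (n0 <= n)%N -> rnorm (u n - l) < e.

Lemma hcvg_cst l : hcvg (fun=> l) l.
Proof. by move=> e e0; exists 0%N => n _; rewrite subrr rnorm0. Qed.

Lemma hcvgD u v l k : hcvg u l -> hcvg v k -> hcvg (fun n => u n + v n) (l + k).
Proof.
move=> ul vk e e0; have e2 : 0 < e / 2 by rewrite divr_gt0.
have [n1 h1] := ul _ e2; have [n2 h2] := vk _ e2; exists (maxn n1 n2) => n.
rewrite geq_max => /andP[/h1 a1 /h2 a2]; rewrite opprD addrACA.
by apply: le_lt_trans (rnormD _ _) _; lra.
Qed.

Lemma hcvg_comp (T : H -> H) u l :
  bounded_op T -> hcvg u l -> hcvg (fun n => T (u n)) (T l).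
Proof.
move=> Tb ul e e0; have [M M0 TM] := bop_bound Tb.
have [|n0 h0] := ul (e / M); first by rewrite divr_gt0.
exists n0 => n /h0; rewrite ltr_pdivlMr// => a.
by rewrite -(bopN Tb) -(bopD Tb); apply: le_lt_trans (TM _) _; rewrite mulrC.
Qed.

Lemma hcvgZ c u l : hcvg u l -> hcvg (fun n => c *: u n) (c *: l).
Proof. exact: (hcvg_comp (bounded_scale c bounded_id)). Qed.

Lemma hcvgN u l : hcvg u l -> hcvg (fun n => - u n) (- l).
Proof. exact: (hcvg_comp (bounded_opp bounded_id)). Qed.

Lemma hcvg_shift u l : hcvg u l -> hcvg (fun n => u n.+1) l.
Proof. by move=> ul e /ul[n0 h]; exists n0 => n nn; apply: h; exact: leqW. Qed.

Lemma hcvg_rdot_le u l k (M : R) :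
  hcvg u l -> (exists n0, forall n, (n0 <= n)%N -> rdot k (u n) <= M) -> rdot k l <= M.
Proof.
move=> ul [n0 uM]; apply/ler_addgt0Pr => e e0.
have k1 : 0 < rnorm k + 1 by have := rnorm_ge0 k; lra.
have [|n1 h] := ul (e / (rnorm k + 1)); first by rewrite divr_gt0.
have := uM _ (leq_maxl n0 n1); have := h _ (leq_maxr n0 n1).
set n := maxn _ _; rewrite ltr_pdivlMr// rnorm_dist => a b.
have -> : rdot k l = rdot k (u n) + rdot k (l - u n) by rewrite rdotDr rdotNr; ring.
apply: lerD => //; apply: le_trans (rdot_le _ _) _.
by have := rnorm_ge0 (l - u n); nra.
Qed.

Lemma hcvg_rdot_ge u l k (M : R) :
  hcvg u l -> (exists n0, forall n, (n0 <= n)%N -> M <= rdot k (u n)) -> M <= rdot k l.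
Proof.
move=> /hcvgN ul [n0 uM]; rewrite -lerN2 -rdotNr; apply: hcvg_rdot_le ul _.
by exists n0 => n /uM; rewrite rdotNr lerN2.
Qed.

Lemma hcvg_unique u l k : hcvg u l -> hcvg u k -> l = k.
Proof.
move=> ul uk; apply/eqP; rewrite -subr_eq0; apply/eqP/rnorm0_eq0/eqP.
rewrite eq_le rnorm_ge0 andbT; apply/ler_addgt0Pr => e e0; rewrite add0r.
have e2 : 0 < e / 2 by rewrite divr_gt0.
have [n1 h1] := ul _ e2; have [n2 h2] := uk _ e2.
have := h1 _ (leq_maxl n1 n2); have := h2 _ (leq_maxr n1 n2).
set n := maxn _ _ => a b; rewrite rnorm_dist in b.
have -> : l - k = (l - u n) + (u n - k) by rewrite addrA subrK.
by apply: le_trans (rnormD _ _) _; lra.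
Qed.

Lemma hcvg_norm_le u l (M : R) :
  hcvg u l -> (forall n, rnorm (u n) <= M) -> rnorm l <= M.
Proof.
move=> ul uM; apply/ler_addgt0Pr => e /ul[n /(_ n (leqnn _))].
rewrite rnorm_dist => a; have -> : l = u n + (l - u n) by rewrite addrC subrK.
by apply: le_trans (rnormD _ _) _; apply: lerD => //; exact: ltW.
Qed.

(** Completeness of the norm with values in [R[i]], in terms of the real norm. *)
Lemma hcauchy_cvg u :
  (forall e : R, 0 < e -> exists n0, forall n, (n0 <= n)%N -> rnorm (u n - u n0) < e) ->
  exists l, hcvg u l.
Proof.
move=> uC; have uc : cauchy (u @ \oo).
  apply: cauchy_exP => e e0.
  have [r er] : exists r : R, e = r%:C.
    by exists (complex.Re e); rewrite RRe_real// gtr0_real.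
  rewrite er ltcR in e0 *; have [n0 h] := uC _ e0.
  exists (u n0); exists n0 => // p /= np.
  by rewrite -ball_normE /= normE ltcR rnorm_dist h.
have [l ul] : exists l : H, u @ \oo --> l by exists (lim (u @ \oo)); exact: cauchy_cvg uc.
exists l => e e0; have /cvgrPdist_lt /(_ e%:C) := ul.
rewrite ltcR => /(_ e0)[n0 _ h]; exists n0 => n nn.
by have := h n nn; rewrite /= normE ltcR rnorm_dist.
Qed.

Lemma near_supremum (f : nat -> R) (M : R) : (forall n, f n <= M) ->
  forall e : R, 0 < e -> exists n0, forall n, f n - f n0 < e.
Proof.
move=> fM e e0; have fs : has_sup (range f).
  by split; [exists (f 0%N), 0%N | exists M => _ [n _ <-]].
have [_ [n0 _ <-] h] := sup_adherent e0 fs; exists n0 => n.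
have : f n <= sup (range f) by apply: ub_le_sup; [exact: fs.2 | exists n].
by lra.
Qed.

(** Increments dominated by those of a bounded real sequence force
    convergence. *)
Lemma hcvg_dominated u (f : nat -> R) (M : R) : (forall n, f n <= M) ->
    (forall n m, (n <= m)%N -> rnorm (u m - u n) <= f m - f n) ->
  exists l, hcvg u l.
Proof.
move=> fM uf; apply: hcauchy_cvg => e /(near_supremum fM)[n0 h].
by exists n0 => n nn; exact: le_lt_trans (uf _ _ nn) _.
Qed.

(** The form suited to strong limits: a square norm [|T_m h - T_n h|^2] is
    compared with an increment of a monotone quadratic form. *)
Lemma hcvg_dominated_sqr u (f : nat -> R) (M : R) : (forall n, f n <= M) ->
    (forall n m, (n <= m)%N -> rnorm (u m - u n) ^+ 2 <= f m - f n) ->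
  exists l, hcvg u l.
Proof.
move=> fM uf; apply: hcauchy_cvg => e e0.
have [|n0 h] := near_supremum fM (_ : 0 < e ^+ 2); first by rewrite exprn_gt0.
exists n0 => n nn; rewrite -(@ltr_pXn2r _ 2)// ?nnegrE ?rnorm_ge0 ?ltW//.
exact: le_lt_trans (uf _ _ nn) _.
Qed.

Lemma bounded_lim (T : nat -> H -> H) (L : H -> H) (M : R) :
    (forall n, bounded_op (T n)) -> (forall n h, rnorm (T n h) <= M * rnorm h) ->
    (forall h, hcvg (T ^~ h) (L h)) ->
  bounded_op L.
Proof.
move=> Tb TM TL; apply: (@bopP _ _ _ M) => [c x y|h]; last exact: hcvg_norm_le (TL h) _.
apply: hcvg_unique (TL _) _; have := hcvgD (hcvgZ c (TL x)) (TL y).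
rewrite (_ : (fun n => _ + _) = T ^~ (c *: x + y))//; apply/funext => n.
by rewrite (bopD (Tb n)) (bopZ (Tb n)).
Qed.

Lemma hcvg_rdot u l k : hcvg u l ->
  (fun n => rdot k (u n)) @ \oo --> rdot k l.
Proof.
move=> ul; apply/cvgrPdist_le => e e0.
have k1 : 0 < rnorm k + 1 by have := rnorm_ge0 k; lra.
have [|n1 h] := ul (e / (rnorm k + 1)); first by rewrite divr_gt0.
exists n1 => // n /h /=; rewrite ltr_pdivlMr// => a.
rewrite ler_norml -rdotNr -rdotDr.
have b1 := rdot_le k (l - u n); have b2 := rdot_le k (u n - l).
have b3 : - rdot k (l - u n) = rdot k (u n - l) by rewrite -rdotNr opprB.
rewrite rnorm_dist in b1; have := rnorm_ge0 (u n - l); nra.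
Qed.

Lemma self_adjoint_lim (T : nat -> H -> H) (L : H -> H) :
    (forall n, self_adjoint (T n)) -> (forall h, hcvg (T ^~ h) (L h)) ->
  self_adjoint L.
Proof.
move=> Ts TL h k; have := hcvg_rdot (k := h) (TL k).
rewrite (_ : (fun n => _) = (fun n => rdot k (T n h))); last first.
  by apply/funext => n; rewrite Ts rdotC.
by move=> a; rewrite (rdotC (L h)); exact: cvg_unique a (hcvg_rdot (k := k) (TL h)).
Qed.

(** Composition is continuous for strong convergence on norm-bounded sets. *)
Lemma hcvg_compose (S T : nat -> H -> H) (K L : H -> H) (M : R) h :
    (forall n, bounded_op (S n)) -> (forall n h, rnorm (S n h) <= M * rnorm h) ->
    (forall h, hcvg (S ^~ h) (K h)) -> (forall h, hcvg (T ^~ h) (L h)) ->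
  hcvg (fun n => S n (T n h)) (K (L h)).
Proof.
move=> Sb SM SK TL.
have M1 : 0 < `|M| + 1 by have := normr_ge0 M; lra.
have d : hcvg (fun n => S n (T n h - L h)) 0.
  move=> e e0; have [|n0 h0] := TL h (e / (`|M| + 1)); first by rewrite divr_gt0.
  exists n0 => n /h0; rewrite ltr_pdivlMr// => a; rewrite subr0.
  apply: le_lt_trans (SM _ _) _; apply: le_lt_trans a.
  rewrite mulrC ler_wpM2l ?rnorm_ge0//; have := ler_norm M; lra.
have := hcvgD d (SK (L h)); rewrite add0r.
rewrite (_ : (fun n => _ + _) = (fun n => S n (T n h)))//; apply/funext => n.
by rewrite -(bopD (Sb n)) subrK.
Qed.

End Convergence.

(** * Polynomials in a bounded operator *)
Section PolynomialCalculus.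
Context {R : realType} {H : hilbertType R}.
Variables (x : H -> H) (xb : bounded_op x).
Implicit Types (p q : {poly R}) (h k : H).

(** Real coefficients are enough here, and they keep polynomials in a
    self-adjoint operator self-adjoint. *)
Definition ev p h : H := \sum_(i < size p) (p`_i)%:C *: iter i x h.

Lemma evE n p h : (size p <= n)%N -> ev p h = \sum_(i < n) (p`_i)%:C *: iter i x h.
Proof.
move=> pn; rewrite /ev (big_ord_widen n (fun i => (p`_i)%:C *: iter i x h) pn) big_mkcond/=.
apply: eq_bigr => i _; case: ifPn => //; rewrite -leqNgt => pi.
by rewrite nth_default// scale0r.
Qed.

Lemma evD p q h : ev (p + q) h = ev p h + ev q h.
Proof.
pose n := maxn (size p) (size q).
rewrite (@evE n (p + q)) ?size_polyD// (@evE n p) ?leq_maxl// (@evE n q) ?leq_maxr//.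
by rewrite -big_split/=; apply: eq_bigr => i _; rewrite coefD rmorphD scalerDl.
Qed.

Lemma evZ c p h : ev (c *: p) h = c%:C *: ev p h.
Proof.
rewrite (@evE (size p)) ?(leq_trans (size_scale_leq _ _))// scaler_sumr.
by apply: eq_bigr => i _; rewrite coefZ rmorphM scalerA.
Qed.

Lemma evN p h : ev (- p) h = - ev p h.
Proof. by rewrite -scaleN1r evZ rmorphN scaleN1r. Qed.

Lemma evC c h : ev c%:P h = c%:C *: h.
Proof. by rewrite (@evE 1) ?size_polyC_leq1// big_ord1 coefC. Qed.

Lemma ev0 h : ev 0 h = 0.
Proof. by rewrite -polyC0 evC scale0r. Qed.

Lemma ev1 h : ev 1 h = h.
Proof. by rewrite -polyC1 evC scale1r. Qed.

Lemma evMX p h : ev (p * 'X) h = x (ev p h).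
Proof.
rewrite (@evE (size p).+1) ?size_polyMX_leq//; last first.
  by have [->|p0] := eqVneq p 0; rewrite ?mul0r ?size_poly0// size_mulX.
rewrite big_ord_recl coefMX/= scale0r add0r /ev.
have xS n (f : 'I_n -> H) : x (\sum_(i < n) f i) = \sum_(i < n) x (f i).
  by apply: (big_morph x); [exact: bopD | exact: bop0].
by rewrite xS; apply: eq_bigr => i _; rewrite coefMX/= (bopZ xb).
Qed.

Lemma evX h : ev 'X h = x h.
Proof. by rewrite -[X in ev X]mul1r evMX ev1. Qed.

Lemma evM p q h : ev (p * q) h = ev p (ev q h).
Proof.
elim/poly_ind: p => [|p c IH]; first by rewrite mul0r !ev0.
rewrite mulrDl -mulrA (mulrC 'X) mulrA !evD !evMX IH mul_polyC evZ.
by rewrite evC.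
Qed.

Lemma bounded_ev p : bounded_op (ev p).
Proof.
elim/poly_ind: p => [|p c IH].
  by have := @bounded_0 _ H; congr bounded_op; apply/funext => h; rewrite ev0.
have := bounded_add (bounded_comp xb IH) (bounded_scale c%:C (@bounded_id _ H)).
by congr bounded_op; apply/funext => h; rewrite evD evMX evC.
Qed.

Lemma ev_commute (B : H -> H) p h : bounded_op B -> (forall k, B (x k) = x (B k)) ->
  B (ev p h) = ev p (B h).
Proof.
move=> Bb Bx; elim/poly_ind: p => [|p c IH]; first by rewrite !ev0 (bop0 Bb).
by rewrite !evD !evMX !evC (bopD Bb) Bx IH (bopZ Bb).
Qed.

Lemma self_adjoint_ev p : self_adjoint x -> self_adjoint (ev p).
Proof.
move=> xs h k; elim/poly_ind: p => [|p c IH] in h k *.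
  by rewrite !ev0 rdot0l rdot0r.
rewrite !evD !evMX !evC !rdotE xs IH -evX -[in RHS]evX -!evM mulrC; ring.
Qed.

Lemma rdot_ev p q h : self_adjoint x -> rdot (ev p h) (ev q h) = rdot h (ev (p * q) h).
Proof. by move=> xs; rewrite evM; rewrite (self_adjoint_ev p xs h (ev q h)). Qed.

Definition nonneg_coefs p := forall i, 0 <= p`_i.

Lemma nonneg_coefsD p q : nonneg_coefs p -> nonneg_coefs q -> nonneg_coefs (p + q).
Proof. by move=> p0 q0 i; rewrite coefD addr_ge0. Qed.

Lemma nonneg_coefsM p q : nonneg_coefs p -> nonneg_coefs q -> nonneg_coefs (p * q).
Proof. by move=> p0 q0 i; rewrite coefM sumr_ge0// => j _; rewrite mulr_ge0. Qed.

Lemma nonneg_coefsC c : 0 <= c -> nonneg_coefs c%:P.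
Proof. by move=> c0 i; rewrite coefC; case: ifP. Qed.

Lemma nonneg_coefs0 : nonneg_coefs 0.
Proof. by move=> i; rewrite coef0. Qed.

Lemma nonneg_coefsX : nonneg_coefs 'X.
Proof. by move=> i; rewrite coefX ler0n. Qed.

(** Positivity of the coefficients turns the triangle inequality into evaluation
    at the norm bound. *)
Lemma ev_norm_le p (r : R) h : (forall k, rnorm (x k) <= r * rnorm k) -> 0 <= r ->
  nonneg_coefs p -> rnorm (ev p h) <= p.[r] * rnorm h.
Proof.
move=> xr r0; elim/poly_ind: p => [|p c IH] pn.
  by rewrite ev0 horner0 rnorm0 mul0r.
have c0 : 0 <= c by have := pn 0%N; rewrite coefD coefMX coefC add0r.
have pn' : nonneg_coefs p.
  by move=> i; have := pn i.+1; rewrite coefD coefMX coefC addr0.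
rewrite evD evMX evC !hornerE; apply: le_trans (rnormD _ _) _.
rewrite rnormZ// mulrDl lerD2r mulrAC; apply: le_trans (xr _) _.
by rewrite mulrC ler_wpM2r// IH.
Qed.

End PolynomialCalculus.

(** * Square roots, inverses and spectral projections *)

Section FunctionalCalculus.
Context {R : realType} {H : hilbertType R}.
Implicit Types (S T B x : H -> H) (p q : {poly R}).

Definition psd T :=
  [/\ bounded_op T, self_adjoint T & forall h, 0 <= rdot h (T h)].

Definition commute_op S T := forall h, S (T h) = T (S h).

(** Only bounded operators are tested, since the clause is used to carry
    commutation through strong limits. *)
Definition in_bicommutant x T :=
  forall B, bounded_op B -> commute_op B x -> commute_op B T.

Lemma in_bicommutant_lim x (p : nat -> {poly R}) L : bounded_op x ->
  (forall h, hcvg (fun n => ev x (p n) h) (L h)) -> in_bicommutant x L.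
Proof.
move=> xb pL B Bb Bx h; have := hcvg_comp Bb (pL h).
rewrite (_ : (fun n => _) = (fun n => ev x (p n) (B h))).
  by move=> a; exact: hcvg_unique a (pL _).
by apply/funext => n; rewrite (ev_commute xb).
Qed.

(** A power series with nonnegative coefficients that converges at [r] can be
    evaluated at every operator of norm at most [r]. *)
Lemma nonneg_series_lim x (r M : R) (p : nat -> {poly R}) : bounded_op x ->
    0 <= r -> (forall h, rnorm (x h) <= r * rnorm h) ->
    nonneg_coefs (p 0) ->
    (forall n, nonneg_coefs (p n.+1 - p n)) ->
    (forall n, (p n).[r] <= M) ->
  exists L, [/\ bounded_op L, forall h, hcvg (fun n => ev x (p n) h) (L h) &
    forall n h, rnorm (ev x (p n) h) <= M * rnorm h].
Proof.
move=> xb r0 xr p0 pS pM.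
have pmn n m : (n <= m)%N -> nonneg_coefs (p m - p n).
  elim: m => [|m IH]; first by rewrite leqn0 => /eqP ->; rewrite subrr; exact: nonneg_coefs0.
  rewrite leq_eqVlt => /predU1P[->|/IH h]; first by rewrite subrr; exact: nonneg_coefs0.
  by rewrite -(subrK (p m) (p m.+1)) -addrA; exact: nonneg_coefsD.
have pn n : nonneg_coefs (p n).
  by rewrite -(subrK (p 0) (p n)); apply: nonneg_coefsD => //; exact: pmn.
have pb n h : rnorm (ev x (p n) h) <= M * rnorm h.
  apply: le_trans (ev_norm_le xb h xr r0 (pn n)) _.
  by rewrite ler_wpM2r ?rnorm_ge0.
have pcvg h : exists l, hcvg (fun n => ev x (p n) h) l.
  apply: (@hcvg_dominated _ _ _ (fun n => (p n).[r] * rnorm h) (M * rnorm h)).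
    by move=> n; rewrite ler_wpM2r ?rnorm_ge0.
  move=> n m nm; rewrite -mulrBl -hornerN -hornerD -evN -evD.
  exact: ev_norm_le (pmn _ _ nm).
have [L pL] := choice pcvg.
by exists L; split=> //; apply: bounded_lim pb pL => n; exact: bounded_ev.
Qed.

(** The power series of [y = 1 - sqrt (1 - t)] has nonnegative coefficients with
    sum [1]. It is approximated by iterating [y = (t + y ^ 2) / 2] from [0], which
    preserves these signs and the bound [1] at [t = 1]. *)
Lemma sqrt_one_sub x : bounded_op x -> self_adjoint x ->
    (forall h, rnorm (x h) <= rnorm h) ->
  exists Q, [/\ bounded_op Q, self_adjoint Q, in_bicommutant x Q &
    forall h, Q (Q h) = h - x h].
Proof.
move=> xb xs x1.
pose Y n : {poly R} := iter n (fun p => 2^-1 *: ('X + p * p)) 0.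
have YS n : Y n.+1 = 2^-1 *: ('X + Y n * Y n) by [].
have half : 0 <= 2^-1 :> R by rewrite invr_ge0.
have nnZ (p : {poly R}) : nonneg_coefs (p) -> nonneg_coefs (2^-1 *: p).
  by move=> pn; rewrite -mul_polyC; apply: nonneg_coefsM => //; exact: nonneg_coefsC.
have Yn n : nonneg_coefs (Y n).
  elim: n => [|n IH]; first exact: nonneg_coefs0.
  by rewrite YS; apply/nnZ/nonneg_coefsD; [exact: nonneg_coefsX|exact: nonneg_coefsM].
have Yd n : nonneg_coefs (Y n.+1 - Y n).
  elim: n => [|n IH]; first by rewrite subr0.
  have -> : Y n.+2 - Y n.+1 = 2^-1 *: ((Y n.+1 - Y n) * (Y n.+1 + Y n)).
    rewrite (YS n.+1) [in X in _ - X](YS n) -scalerBr; congr (_ *: _); ring.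
  by apply/nnZ/nonneg_coefsM => //; exact: nonneg_coefsD.
have Y1 n : 0 <= (Y n).[1] <= 1.
  elim: n => [|n /andP[a b]]; first by rewrite horner0 lexx ler01.
  by rewrite YS !hornerE; nra.
have x1' h : rnorm (x h) <= 1 * rnorm h by rewrite mul1r.
have Yle1 n : (Y n).[1] <= 1 by have /andP[] := Y1 n.
have [L [Lb YL Yb]] := nonneg_series_lim xb ler01 x1' nonneg_coefs0 Yd Yle1.
(* Strong continuity of composition passes the recursion to the limit. *)
have Lfix h : (2 : R)%:C *: L h = x h + L (L h).
  apply: hcvg_unique (hcvgZ _ (hcvg_shift (YL h))) _.
  have LL := hcvg_compose h (fun n => bounded_ev xb (Y n)) Yb YL YL.
  have := hcvgD (hcvg_cst (x h)) LL.
  rewrite (_ : (fun n => _ + _) = (fun n => 2%:C *: ev x (Y n.+1) h))//.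
  apply/funext => n; rewrite YS evZ evD evX// (evM xb) scalerA -rmorphM.
  by rewrite divff ?scale1r// pnatr_eq0.
have Ls : self_adjoint L by apply: self_adjoint_lim YL => n; exact: self_adjoint_ev.
exists (fun h => h - L h); split.
- exact: bounded_sub bounded_id Lb.
- by move=> h k; rewrite !rdotE Ls.
- move=> B Bb Bx h; rewrite (bopD Bb) (bopN Bb).
  by rewrite (in_bicommutant_lim xb YL Bb Bx).
- move=> h; apply: rdot_inj => k; have := congr1 (rdot k) (Lfix h).
  by rewrite (bopD Lb) (bopN Lb) !rdotE; lra.
Qed.

(** Rescaling by a norm bound [M] reduces to [sqrt_one_sub] for
    [x = 1 - M^-1 G], which is a positive contraction. *)
Lemma sqrt_op G : psd G ->
  exists Z, [/\ bounded_op Z, self_adjoint Z, in_bicommutant G Z &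
    forall h, Z (Z h) = G h].
Proof.
move=> [Gb Gs Gp]; have [M M0 GM] := bounded_rdot Gb.
pose x h := h - (M^-1)%:C *: G h.
have xb : bounded_op x by apply: bounded_sub bounded_id _; exact: bounded_scale.
have xs : self_adjoint x by move=> h k; rewrite !rdotE Gs.
have [|Q [Qb Qs Qc QQ]] := sqrt_one_sub xb xs.
  move=> h; rewrite -[leRHS]mul1r; apply: positive_norm_le => // k; rewrite !rdotE.
    rewrite subr_ge0 -(@ler_pM2l _ M)// mulrA divff ?mul1r// gt_eqF//.
  by rewrite mul1r gerBl mulr_ge0// invr_ge0 ltW.
exists (fun h => (Num.sqrt M)%:C *: Q h); split.
- exact: bounded_scale.
- by move=> h k; rewrite !rdotE Qs.
- move=> B Bb BG h; rewrite (bopZ Bb); congr (_ *: _); apply: Qc => // k.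
  by rewrite /x (bopD Bb) (bopN Bb) (bopZ Bb) BG.
- move=> h; rewrite (bopZ Qb) QQ scalerA -rmorphM -expr2 sqr_sqrtr ?ltW//.
  by rewrite /x opprB addrC subrK scalerA -rmorphM divff ?scale1r// gt_eqF.
Qed.

Definition inverse_op S T := (forall h, S (T h) = h) /\ (forall h, T (S h) = h).

(** Neumann series for the inverse of an operator bounded below. *)
Lemma inverse_of_lower_bound S (e : R) : psd S -> 0 < e ->
    (forall h, e * rdot h h <= rdot h (S h)) ->
  exists G, psd G /\ inverse_op S G.
Proof.
move=> [Sb Ss Sp] e0 Se; have [M0 M00 SM0] := bounded_rdot Sb.
(* Adding [e] to the bound makes [e / M <= 1] even on the zero space. *)
pose M := M0 + e; have M1 : 0 < M by rewrite addr_gt0.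
have SM h : rdot h (S h) <= M * rdot h h.
  by apply: le_trans (SM0 h) _; rewrite ler_wpM2r ?rdotxx_ge0// /M; lra.
pose r := 1 - e / M.
have r0 : 0 <= r by rewrite subr_ge0 ler_pdivrMr// mul1r /M; lra.
have r1 : 0 < 1 - r by rewrite /r opprB addrC subrK divr_gt0.
pose x h := h - (M^-1)%:C *: S h.
have xb : bounded_op x by apply: bounded_sub bounded_id _; exact: bounded_scale.
have xs : self_adjoint x by move=> h k; rewrite !rdotE Ss.
have Mi : 0 < M^-1 by rewrite invr_gt0.
have MM : M^-1 * M = 1 by rewrite mulVf// gt_eqF.
have xr h : rnorm (x h) <= r * rnorm h.
  apply: positive_norm_le => // k; rewrite !rdotE; have SMk := SM k; have Sek := Se k.
    by rewrite subr_ge0 -(@ler_pM2l _ M)// mulrA mulfV ?mul1r// gt_eqF.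
  have : M^-1 * (e * rdot k k) <= M^-1 * rdot k (S k) by rewrite ler_pM2l.
  by rewrite /r mulrBl mul1r (mulrC e M^-1) mulrA; lra.
pose Y n : {poly R} := iter n (fun p => 1 + 'X * p) 0.
have YS n : Y n.+1 = 1 + 'X * Y n by [].
have Yd n : nonneg_coefs (Y n.+1 - Y n).
  elim: n => [|n IH].
    by rewrite subr0 /Y/= mulr0 addr0 -polyC1; exact: (nonneg_coefsC ler01).
  rewrite (YS n.+1) [in X in _ - X](YS n) (_ : _ - _ = 'X * (Y n.+1 - Y n)); last by ring.
  by apply: nonneg_coefsM => //; exact: nonneg_coefsX.
have Yr n : (Y n).[r] <= (1 - r)^-1.
  elim: n => [|n IH]; first by rewrite horner0 invr_ge0 ltW.
  rewrite YS !hornerE (_ : (1 - r)^-1 = 1 + r * (1 - r)^-1).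
    by rewrite lerD2l ler_wpM2l.
  by field; rewrite gt_eqF.
have [L [Lb YL Yb]] := nonneg_series_lim xb r0 xr nonneg_coefs0 Yd Yr.
have Lfix h : L h = h + x (L h).
  apply: hcvg_unique (hcvg_shift (YL h)) _.
  have := hcvgD (hcvg_cst h) (hcvg_comp xb (YL h)).
  rewrite (_ : (fun n => _ + _) = (fun n => ev x (Y n.+1) h))//.
  by apply/funext => n; rewrite YS evD (evM xb) ev1 evX.
have Ls : self_adjoint L by apply: self_adjoint_lim YL => n; exact: self_adjoint_ev.
have Lx : commute_op x L by apply: (in_bicommutant_lim xb YL).
pose G h := (M^-1)%:C *: L h.
have Gb : bounded_op G by exact: bounded_scale.
have SG h : S (G h) = h.
  apply: rdot_inj => k; have := congr1 (rdot k) (Lfix h).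
  by rewrite /x (bopZ Sb) !rdotE; lra.
have GS h : G (S h) = h.
  have SL : S (L h) = L (S h).
    have := Lx h; rewrite /x (bopD Lb) (bopN Lb) (bopZ Lb) => /addrI/oppr_inj/scalerI.
    by apply; rewrite fmorph_eq0 gt_eqF.
  by rewrite -[RHS]SG /G -SL (bopZ Sb).
have Gs : self_adjoint G by move=> h k; rewrite !rdotE Ls.
exists G; split; last by split.
by split=> // h; rewrite -{1}(SG h) -Ss.
Qed.

(** The preordering of polynomials certified nonnegative on [-1, 1] by squares
    and the weight [1 - t ^ 2]. *)
Inductive interval_cone : {poly R} -> Prop :=
| ConeSq c q : 0 <= c -> interval_cone (c *: (q * q))
| ConeWt c q : 0 <= c -> interval_cone (c *: (q * q * (1 - 'X * 'X)))
| ConeAdd p q : interval_cone p -> interval_cone q -> interval_cone (p + q).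

(** Stable because [1 - t ^ 2] occurs at most once per generator, and its square
    is a square. *)
Lemma interval_coneM p q : interval_cone p -> interval_cone q -> interval_cone (p * q).
Proof.
move=> pc; elim: pc q => {p} [c p c0|c p c0|p p' _ IH _ IH'] q; last first.
- by move=> qc; rewrite mulrDl; apply: ConeAdd; [exact: IH|exact: IH'].
- elim=> {q} [d q d0|d q d0|q q' _ IH _ IH']; last by rewrite mulrDr; exact: ConeAdd.
  + rewrite (_ : _ * _ = (c * d) *: ((p * q) * (p * q) * (1 - 'X * 'X))).
      by apply: ConeWt; exact: mulr_ge0.
    rewrite -scalerAl -scalerAr scalerA; congr (_ *: _); ring.
  + rewrite (_ : _ * _ = (c * d) *: ((p * q * (1 - 'X * 'X)) * (p * q * (1 - 'X * 'X)))).
      by apply: ConeSq; exact: mulr_ge0.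
    rewrite -scalerAl -scalerAr scalerA; congr (_ *: _); ring.
- elim=> {q} [d q d0|d q d0|q q' _ IH _ IH']; last by rewrite mulrDr; exact: ConeAdd.
  + rewrite (_ : _ * _ = (c * d) *: ((p * q) * (p * q))).
      by apply: ConeSq; exact: mulr_ge0.
    rewrite -scalerAl -scalerAr scalerA; congr (_ *: _); ring.
  + rewrite (_ : _ * _ = (c * d) *: ((p * q) * (p * q) * (1 - 'X * 'X))).
      by apply: ConeWt; exact: mulr_ge0.
    rewrite -scalerAl -scalerAr scalerA; congr (_ *: _); ring.
Qed.

Lemma interval_cone_sq p : interval_cone (p * p).
Proof. by rewrite -[_ * _]scale1r; exact: ConeSq. Qed.

Lemma interval_cone_wt : interval_cone (1 - 'X * 'X).
Proof.
by have := ConeWt 1 (@ler01 R); rewrite scale1r !mul1r.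
Qed.

Lemma interval_coneC c : 0 <= c -> interval_cone c%:P.
Proof. by move=> c0; rewrite -[c%:P]mulr1 mul_polyC -[1]mulr1; exact: ConeSq. Qed.

Lemma interval_cone_ge0 x p h : bounded_op x -> self_adjoint x ->
    (forall h, rnorm (x h) <= rnorm h) -> interval_cone p -> 0 <= rdot h (ev x p h).
Proof.
move=> xb xs x1; elim=> {p} [c q c0|c q c0|p q _ p0 _ q0].
- by rewrite evZ rdotZr mulr_ge0// -rdot_ev// rdotxx_ge0.
- rewrite evZ rdotZr mulr_ge0//.
  rewrite (_ : _ * _ = q * q - (q * 'X) * (q * 'X)); last by ring.
  rewrite evD evN rdotDr rdotNr -!rdot_ev// subr_ge0 !rdotxx evMX//.
  by rewrite ler_pXn2r ?nnegrE ?rnorm_ge0.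
- by rewrite evD rdotDr addr_ge0.
Qed.

(** The Newton-Schulz iteration [w <- w (3 - w ^ 2) / 2] started at [t] converges
    to the sign of [t] on [-1, 1]. The convergence is not uniform; it is strong
    on operators because the squares of the iterates increase. *)
Definition newton_schulz n : {poly R} :=
  iter n (fun w => w + 2^-1 *: (w * (1 - w * w))) 'X.

Lemma newton_schulzS n : newton_schulz n.+1 =
  newton_schulz n * (1 + 2^-1 *: (1 - newton_schulz n * newton_schulz n)).
Proof. by rewrite mulrDr mulr1 -scalerAr. Qed.

(** The defect [e = 1 - w ^ 2] of an iterate satisfies
    [e' = e ^ 2 (3 + e) / 4], so it stays in the cone. *)
Lemma newton_schulz_defect n :
  interval_cone (1 - newton_schulz n * newton_schulz n).
Proof.
elim: n => [|n IH]; first exact: interval_cone_wt.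
rewrite newton_schulzS -mul_polyC; set w := newton_schulz n in IH *.
set e := 1 - w * w in IH *.
have -> : 1 - w * (1 + 2^-1%:P * e) * (w * (1 + 2^-1%:P * e)) =
    (e * e) * ((3 / 4)%:P + 4^-1%:P * e).
  have -> : 4^-1%:P = 2^-1%:P * 2^-1%:P :> {poly R}.
    by rewrite -polyCM -invfM; congr (_^-1%:P); rewrite -natrM.
  have -> : (3 / 4)%:P = 1 - 2^-1%:P * 2^-1%:P :> {poly R}.
    by rewrite -polyCM -polyC1 -polyCB; congr (_ %:P); field.
  have : 2^-1%:P + 2^-1%:P = 1 :> {poly R}.
    by rewrite -polyCD -polyC1; congr (_ %:P); field.
  move: (2^-1%:P) => c c1.
  rewrite mulrACA (_ : (1 + c * e) * (1 + c * e) = 1 + e + c * c * (e * e)).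
    rewrite /e; ring.
  by transitivity (1 + (c + c) * e + c * c * (e * e)); [ring|rewrite c1 mul1r].
apply: interval_coneM; first exact: interval_cone_sq.
apply: ConeAdd; first by apply: interval_coneC; lra.
by apply: interval_coneM => //; apply: interval_coneC; lra.
Qed.

(** The factor [1 + g] being at least [1], both [w_m w_n - w_n ^ 2] and
    [w_m ^ 2 - w_n ^ 2] are in the cone for [n <= m]; these two facts make the
    iterates strongly Cauchy. *)
Lemma newton_schulz_factor n m : (n <= m)%N -> exists2 g,
  newton_schulz m = newton_schulz n * (1 + g) & interval_cone g.
Proof.
elim: m => [|m IH].
  rewrite leqn0 => /eqP ->; exists 0; rewrite ?addr0 ?mulr1//.
  exact: (interval_coneC (lexx 0)).
rewrite leq_eqVlt => /predU1P[->|/IH[g mE gc]].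
  exists 0; rewrite ?addr0 ?mulr1//; exact: (interval_coneC (lexx 0)).
have := newton_schulz_defect m; have := newton_schulzS m.
move: (1 - newton_schulz m * newton_schulz m) => e -> ec.
have ec2 : interval_cone (2^-1 *: e).
  by rewrite -mul_polyC; apply: interval_coneM => //; apply: interval_coneC; lra.
exists (g + 2^-1 *: e + g * (2^-1 *: e)).
  by rewrite mE; move: (2^-1 *: e) => f; ring.
by apply: ConeAdd; [exact: ConeAdd|exact: interval_coneM].
Qed.

(** Spectral projection of a self-adjoint contraction for [[0, +oo[], extracted
    from its sign [w] as the nonnegative part [(w ^ 2 + w) / 2]. *)
Lemma spectral_projection_contraction x : bounded_op x -> self_adjoint x ->
    (forall h, rnorm (x h) <= rnorm h) ->
  exists P, [/\ bounded_op P, self_adjoint P, forall h, P (P h) = P h,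
    in_bicommutant x P &
    (forall h, 0 <= rdot (P h) (x (P h))) /\
    (forall h, rdot (h - P h) (x (h - P h)) <= 0)].
Proof.
move=> xb xs x1; pose W := newton_schulz.
have cone_ge0 := interval_cone_ge0 _ xb xs x1.
have W1 n h : rnorm (ev x (W n) h) <= 1 * rnorm h.
  rewrite mul1r -(@ler_pXn2r _ 2)// ?nnegrE ?rnorm_ge0// -!rdotxx rdot_ev//.
  by have := cone_ge0 _ h (newton_schulz_defect n); rewrite evD evN ev1 rdotDr rdotNr subr_ge0.
have Wf n m : (n <= m)%N -> exists2 g, W m = W n * (1 + g) & interval_cone g.
  exact: newton_schulz_factor.
have Wcvg h : exists l, hcvg (fun n => ev x (W n) h) l.
  apply: (@hcvg_dominated_sqr _ _ _ (fun n => rdot h (ev x (W n * W n) h)) (rdot h h)).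
    move=> n; have := cone_ge0 _ h (newton_schulz_defect n).
    by rewrite evD evN ev1 rdotDr rdotNr subr_ge0.
  move=> n m /Wf[g -> gc]; rewrite -rdotxx -evN -evD rdot_ev//.
  rewrite -rdotNr -evN -rdotDr -evD -subr_ge0 -rdotNr -evN -rdotDr -evD.
  apply: cone_ge0.
  rewrite (_ : _ - _ = W n * W n * (g + g)); last by ring.
  by apply: interval_coneM; [exact: interval_cone_sq|exact: ConeAdd].
have [w Ww] := choice Wcvg.
have wb : bounded_op w by apply: bounded_lim W1 Ww => n; exact: bounded_ev.
have ws : self_adjoint w by apply: self_adjoint_lim Ww => n; exact: self_adjoint_ev.
have wx := in_bicommutant_lim xb Ww.
have Wb n := bounded_ev xb (W n).
(* Fixed points of the iteration satisfy [w ^ 3 = w]. *)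
have www h : w (w (w h)) = w h.
  have c1 k := hcvg_compose k Wb W1 Ww Ww.
  have c2 := hcvgD (hcvgZ (3 / 2)%:C (Ww h)) (hcvgZ (- 2^-1)%:C (hcvg_compose h Wb W1 Ww c1)).
  have := hcvg_unique (hcvg_shift (Ww h)).
  move=> /(_ ((3 / 2)%:C *: w h + (- 2^-1)%:C *: w (w (w h)))).
  rewrite (_ : (fun n => _) =
      (fun n => (3 / 2)%:C *: ev x (W n) h + (- 2^-1)%:C *: ev x (W n) (ev x (W n) (ev x (W n) h)))).
    move=> /(_ c2) e; apply: rdot_inj => k; have := congr1 (rdot k) e.
    by rewrite !rdotE; lra.
  apply/funext => n; rewrite /W newton_schulzS -/(W n).
  rewrite mulrDr mulr1 -scalerAr mulrBr mulr1 !(evD, evZ, evN, evM)//.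
  by apply: rdot_inj => k; rewrite !rdotE; lra.
have xw_ge0 h : 0 <= rdot h (x (w h)).
  apply: hcvg_rdot_ge (hcvg_comp xb (Ww h)) _; exists 0%N => n _.
  rewrite -(evX xb) -(evM xb); apply: cone_ge0.
  have [g -> gc] := Wf _ _ (leq0n n).
  rewrite (_ : W 0%N = 'X)// mulrA; apply: interval_coneM; first exact: interval_cone_sq.
  by apply: ConeAdd => //; exact: interval_coneC ler01.
have x_le_w h : rdot (x h) (x h) <= rdot (w h) (w h).
  rewrite -ws; have c1 := hcvg_compose h Wb W1 Ww Ww.
  apply: hcvg_rdot_ge c1 _; exists 0%N => n _.
  rewrite -(evM xb) -(evX xb h) (rdot_ev xb)// -subr_ge0 -rdotNr -evN -rdotDr -evD.
  apply: cone_ge0; have [g -> gc] := Wf _ _ (leq0n n).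
  rewrite (_ : W 0%N = 'X)// (_ : _ - _ = 'X * 'X * (g + (g + g * g))); last by ring.
  apply: interval_coneM; first exact: interval_cone_sq.
  by apply: ConeAdd => //; apply: ConeAdd => //; exact: interval_coneM.
(* [w ^ 2] is the projection onto the complement of the kernel of [x]. *)
have xww h : x (w (w h)) = x h.
  have h0 : w (h - w (w h)) = 0 by rewrite (bopD wb) (bopN wb) www subrr.
  have := x_le_w (h - w (w h)); rewrite h0 rdot0r => /rdotxx_le0.
  by rewrite (bopD xb) (bopN xb) => /eqP; rewrite subr_eq0 => /eqP.
pose P h := (2^-1)%:C *: (w (w h) + w h).
have wP h : w (P h) = P h.
  by rewrite /P (bopZ wb) (bopD wb) www addrC.
have PP h : P (P h) = P h.
  by rewrite {1}/P !wP; apply: rdot_inj => k; rewrite !rdotE; lra.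
have Pb : bounded_op P by apply: bounded_scale; apply: bounded_add => //; exact: bounded_comp.
exists P; split=> //.
- by move=> h k; rewrite !rdotE !ws.
- move=> B Bb Bx h; have Bw := wx _ Bb Bx.
  by rewrite /P (bopZ Bb) (bopD Bb) !Bw.
split=> h; first by rewrite -{2}wP.
(* On [g] the operator [w] acts as [- w ^ 2], hence [x] as [- x w <= 0]. *)
set g := h - P h; have Pg : P g = 0 by rewrite (bopD Pb) (bopN Pb) PP subrr.
have -> : x g = - x (w g).
  rewrite -xww -(bopN xb); congr (x _); apply: rdot_inj => k.
  by have := congr1 (rdot k) Pg; rewrite !rdotE rdot0r; lra.
by rewrite rdotNr oppr_le0.
Qed.

Lemma spectral_projection a (l : R) : bounded_op a -> self_adjoint a ->
  exists P, [/\ bounded_op P, self_adjoint P, forall h, P (P h) = P h,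
    in_bicommutant a P &
    (forall h, l * rdot (P h) (P h) <= rdot (P h) (a (P h))) /\
    (forall h, rdot (h - P h) (a (h - P h)) <= l * rdot (h - P h) (h - P h))].
Proof.
move=> ab as_; pose y h := a h - l%:C *: h.
have yb : bounded_op y by apply: bounded_sub => //; exact: bounded_scale bounded_id.
have [M M0 yM] := bop_bound yb.
have Mi : 0 < M^-1 by rewrite invr_gt0.
pose x h := (M^-1)%:C *: y h.
have xb : bounded_op x by exact: bounded_scale.
have xs : self_adjoint x by move=> h k; rewrite !rdotE as_.
have [h|P [Pb Ps PP Pc [P1 P2]]] := spectral_projection_contraction xb xs.
  by rewrite (rnormZ _ (ltW Mi)) ler_pdivrMl.
exists P; split=> //.
  move=> B Bb Ba; apply: Pc => // h.
  by rewrite /x /y (bopZ Bb) (bopD Bb) (bopN Bb) (bopZ Bb) Ba.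
split=> h; first by have := P1 h; rewrite !rdotZr pmulr_rge0// rdotDr rdotNr rdotZr subr_ge0.
by have := P2 h; rewrite rdotZr pmulr_rle0// /y; set g := h - P h; rewrite rdotDr rdotNr rdotZr subr_le0.
Qed.

End FunctionalCalculus.

(** * Complex measures and positive operator valued measures *)

Section ComplexMeasures.
Context {R : realType} {d : measure_display} {X : measurableType d}.
Implicit Types (nu : set X -> R[i]) (A B : set X).

Lemma complex_measure_eq nu nu' : (forall A, measurable A -> nu A = nu' A) ->
  complex_measure nu -> complex_measure nu'.
Proof.
move=> e nuC F Fm Ft; rewrite -e; last exact: bigcupT_measurable.
rewrite (_ : (fun n => _) = (fun n => \sum_(0 <= i < n) nu (F i))); first exact: nuC.
by apply/funext => n; apply: eq_bigr => i _; rewrite e.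
Qed.

Lemma complex_measureD nu nu' : complex_measure nu -> complex_measure nu' ->
  complex_measure (fun A => nu A + nu' A).
Proof.
move=> nuC nuC' F Fm Ft.
rewrite (_ : (fun n => _) = (fun n => \sum_(0 <= i < n) nu (F i)) \+
   (fun n => \sum_(0 <= i < n) nu' (F i))).
  by apply: (@cvgD _ R[i]^o); [exact: nuC|exact: nuC'].
by apply/funext => n; rewrite big_split.
Qed.

Lemma complex_measureZ (c : R[i]) nu : complex_measure nu ->
  complex_measure (fun A => c * nu A).
Proof.
move=> nuC F Fm Ft.
rewrite (_ : (fun n => _) = (fun n => c *: (\sum_(0 <= i < n) nu (F i) : R[i]^o))).
  by apply: (@cvgZr _ R[i]^o); exact: nuC.
by apply/funext => n; rewrite -mulr_sumr.
Qed.

Lemma complex_measure_restrict nu A : measurable A -> complex_measure nu ->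
  complex_measure (fun B => nu (B `&` A)).
Proof.
move=> Am nuC F Fm Ft; rewrite setI_bigcupl; apply: nuC => [n|].
  exact: measurableI.
by apply/trivIsetP => i j _ _ ij; move/trivIsetP: Ft => /(_ i j I I ij);
   rewrite setIACA => ->; rewrite set0I.
Qed.

(** With all sets empty, the increments of the convergent partial sums are
    constantly [nu set0]. *)
Lemma complex_measure0 nu : complex_measure nu -> nu set0 = 0.
Proof.
move=> nuC; have F0 : trivIset [set: nat] (fun=> set0 : set X) by move=> i j _ _ [x []].
have := nuC (fun=> set0) (fun=> measurable0) F0.
rewrite bigcup0// => c.
have c' : (fun n => \sum_(0 <= i < n.+1) nu set0) @ \oo --> (nu set0 : R[i]^o).
  have sh : (fun n => n.+1) @ \oo --> \oo by exact: cvg_addnl 1.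
  exact: cvg_comp sh c.
have := @cvgB _ R[i]^o _ _ _ _ _ _ _ c' c.
rewrite subrr (_ : (_ - _ : nat -> R[i]^o) = (fun=> nu set0)).
  move=> c0; have c1 : (fun _ : nat => nu set0) @ \oo --> (nu set0 : R[i]^o).
    by apply: (@cvg_cst R[i]^o).
  exact: (cvg_unique (@norm_hausdorff _ R[i]^o) c1 (c0 _)).
by apply/funext => n; rewrite !fctE big_nat_recr//= addrAC subrr add0r.
Qed.

Lemma complex_measureU nu A B : complex_measure nu -> measurable A ->
  measurable B -> A `&` B = set0 -> nu (A `|` B) = nu A + nu B.
Proof.
move=> nuC Am Bm AB.
have Fm n : measurable (bigcup2 A B n) by case: n => [|[|n]]//=.
have Ft : trivIset setT (bigcup2 A B) by rewrite -trivIset_bigcup2.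
have := nuC _ Fm Ft; rewrite bigcup2E => c.
have {}c : (fun n => \sum_(0 <= i < n + 2) nu (bigcup2 A B i)) @ \oo -->
   (nu (A `|` B) : R[i]^o).
  exact: cvg_comp (cvg_addnr 2) c.
have c' : (fun n => \sum_(0 <= i < n + 2) nu (bigcup2 A B i)) @ \oo -->
   (nu A + nu B : R[i]^o).
  rewrite (_ : (fun n => _) = (fun=> nu A + nu B)); first by apply: (@cvg_cst R[i]^o).
  apply/funext => n; rewrite addn2 big_nat_recl//= big_nat_recl//= big1 ?addr0// => i _.
  exact: complex_measure0.
exact: (cvg_unique (@norm_hausdorff _ R[i]^o) c c').
Qed.

End ComplexMeasures.

Section PovmTheory.
Context {R : realType} {d : measure_display} {X : measurableType d}
  {H : hilbertType R}.
Implicit Types (mu : set X -> H -> H) (A B : set X).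

Lemma povm_psd mu A : povm mu -> measurable A -> psd (mu A).
Proof.
move=> [mub mup _] Am; have [ms mp] := (positive_opP (mub A Am)).1 (mup A Am).
by split=> //; exact: mub.
Qed.

Lemma povm0 mu h : povm mu -> mu set0 h = 0.
Proof.
move=> [_ _ muC]; apply: rdot_inj => k; rewrite rdot0r /rdot.
by rewrite (complex_measure0 (muC k h)).
Qed.

Lemma povmU mu A B h : povm mu -> measurable A -> measurable B ->
  A `&` B = set0 -> mu (A `|` B) h = mu A h + mu B h.
Proof.
move=> [_ _ muC] Am Bm AB; apply: rdot_inj => k; rewrite rdotDr /rdot.
by rewrite (complex_measureU (muC k h))// raddfD.
Qed.

Lemma povm_split mu A B h : povm mu -> measurable A -> measurable B ->
  mu B h = mu (B `&` A) h + mu (B `&` ~` A) h.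
Proof.
move=> muP Am Bm; rewrite -povmU//.
- by rewrite -setIUr setUv setIT.
- exact: measurableI.
- by apply: measurableI => //; exact: measurableC.
- by rewrite setIACA setICr setI0.
Qed.

Lemma povmC mu A h : normalized_povm mu -> measurable A ->
  mu (~` A) h = h - mu A h.
Proof.
move=> [muP mu1] Am; have := povm_split h muP Am (@measurableT _ X).
by rewrite !setTI mu1 => {2}->; rewrite addrAC subrr add0r.
Qed.

Lemma povm_le mu A B h : povm mu -> measurable A -> measurable B -> A `<=` B ->
  rdot h (mu A h) <= rdot h (mu B h).
Proof.
move=> muP Am Bm AB; rewrite (povm_split h muP Am Bm) (setIidr AB) rdotDr lerDl.
have [] // := povm_psd muP (measurableI B (~` A) Bm _); exact: measurableC.
Qed.

Lemma povm_le1 mu A h : normalized_povm mu -> measurable A ->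
  rdot h (mu A h) <= rdot h h.
Proof.
move=> [muP mu1] Am.
by have := povm_le h muP Am (@measurableT _ X) (@subsetT _ A); rewrite mu1.
Qed.

Lemma povm_null_sub mu A B : povm mu -> measurable A -> measurable B ->
  A `<=` B -> mu B = 0 -> mu A = 0.
Proof.
move=> muP Am Bm AB B0; have [Ab As Ap] := povm_psd muP Am.
apply/funext => h; apply: positive_null => //.
by apply: le_trans (povm_le h muP Am Bm AB) _; rewrite B0 rdot0r.
Qed.

Lemma projectionP mu A : povm mu -> measurable A ->
  projection (mu A) <-> forall h, mu A (mu A h) = mu A h.
Proof.
move=> muP Am; have [Ab As _] := povm_psd muP Am; split=> [[_ PP] h|PP].
  exact: (congr1 (fun f => f h) PP).
by split; [exact: adj_self|apply/funext => h; exact: PP].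
Qed.

(** * Spectral measures are extreme *)

(** If [mu A h] vanishes, then so does each of the nonnegative summands
    [<T_i h, nu_i A (T_i h)>] of [<h, mu A h>]. On both ranges of [mu A] and
    [1 - mu A] this pins down [nu_i A] after [T_i]. *)
Lemma spectral_intertwines mu n (nu : 'I_n -> set X -> H -> H)
    (T : 'I_n -> H -> H) :
  spectral_measure mu -> (forall i, normalized_povm (nu i)) ->
  (forall i, bounded_op (T i)) ->
  (forall A, measurable A -> mu A = \sum_i (adj (T i) \o nu i A \o T i)) ->
  forall i A h, measurable A -> nu i A (T i h) = T i (mu A h).
Proof.
move=> [muN muPr] nuN Tb muE i.
have key A h : measurable A -> mu A h = 0 -> nu i A (T i h) = 0.
  move=> Am A0; have nup j := povm_psd (nuN j).1 Am.
  have [nb ns np] := nup i; apply: positive_null => //.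
  have rS (f : 'I_n -> H) : rdot h (\sum_j f j) = \sum_j rdot h (f j).
    by apply: (big_morph (rdot h)); [exact: rdotDr|exact: rdot0r].
  have : \sum_j rdot (T j h) (nu j A (T j h)) = 0.
    have := congr1 (fun f => rdot h (f h)) (muE A Am); rewrite A0 rdot0r fct_sumE rS.
    move=> e; rewrite [RHS]e; apply: eq_bigr => j _ /=.
    by rewrite [RHS]rdotC -(is_adjoint_rdot _ _ (adjP (Tb j))); exact: rdotC.
  move=> e; rewrite -e (bigD1 i)//= lerDl sumr_ge0// => j _.
  by have [_ _ ->] := nup j.
move=> A h Am; have Amc := measurableC Am.
have [Pb Ps _] := povm_psd muN.1 Am; have [nb _ _] := povm_psd (nuN i).1 Am.
have PP := (projectionP muN.1 Am).1 (muPr _ Am).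
have e1 : nu i A (T i (h - mu A h)) = 0.
  by apply: key => //; rewrite (bopD Pb) (bopN Pb) PP subrr.
have e2 : nu i (~` A) (T i (mu A h)) = 0.
  by apply: key => //; rewrite povmC// PP subrr.
move: e2; rewrite povmC// => /eqP; rewrite subr_eq0 => /eqP ->.
move: e1; rewrite (bopD (Tb i)) (bopN (Tb i)) (bopD nb) (bopN nb).
by move=> /eqP; rewrite subr_eq0 => /eqP.
Qed.

(** Similarity of two families of self-adjoint operators upgrades to
    unitary equivalence by replacing [T] with its unitary polar part
    [T (T^* T)^(-1/2)]. *)
Lemma intertwining_polar (T : H -> H) (I : Type) (a b : I -> H -> H) :
  bounded_op T -> invertible_op T ->
  (forall i, bounded_op (a i) /\ self_adjoint (a i)) ->
  (forall i, bounded_op (b i) /\ self_adjoint (b i)) ->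
  (forall i h, b i (T h) = T (a i h)) ->
  exists U, unitary_op U /\ forall i, b i = adj U \o a i \o U.
Proof.
move=> Tb [V [Vb VT TV]] aP bP bT.
have {}VT h : V (T h) = h by exact: (congr1 (@^~ h) VT).
have {}TV h : T (V h) = h by exact: (congr1 (@^~ h) TV).
pose Ta := adj T; pose Va := adj V.
have Tab : bounded_op Ta by exact: bounded_adj.
have Vab : bounded_op Va by exact: bounded_adj.
have rT h k : rdot h (T k) = rdot (Ta h) k by exact/is_adjoint_rdot/adjP.
have rV h k : rdot h (V k) = rdot (Va h) k by exact/is_adjoint_rdot/adjP.
have TVa h : Ta (Va h) = h.
  by apply: rdot_inj => k; rewrite rdotC -rT -rV VT rdotC.
have VTa h : Va (Ta h) = h.
  by apply: rdot_inj => k; rewrite rdotC -rV -rT TV rdotC.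
have VVp : psd (fun h => V (Va h)).
  split=> [|h k|h]; first exact: bounded_comp.
    by rewrite rV [RHS]rdotC rV rdotC.
  by rewrite rV rdotxx_ge0.
have [Z [Zb Zs Zc ZZ]] := sqrt_op VVp.
(* [T^* T] and [V V^*] are inverse to each other, so [Z] commutes with both. *)
have ZTT h : Z (Ta (T h)) = Ta (T (Z h)).
  rewrite -(Zc (fun h => Ta (T h)))//; first exact: bounded_comp.
  by move=> k; rewrite TV TVa VTa VT.
have Za i h : a i (Z h) = Z (a i h).
  have [ab as_] := aP i; have [bb bs] := bP i.
  apply: Zc => // k.
  have aV l : a i (V l) = V (b i l) by rewrite -{2}(TV l) bT VT.
  rewrite aV; congr (V _); symmetry; apply: rdot_inj => l.
  by rewrite bs [RHS]rdotC -rV -aV as_ rV rdotC.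
pose U h := Z (Ta h); pose W h := T (Z h).
have Ub : bounded_op U by exact: bounded_comp.
have Wb : bounded_op W by exact: bounded_comp.
have UW : adj U = W.
  apply/adj_uniq/is_adjointP => // h k.
  by rewrite /U /W Zs rdotC -rT rdotC.
exists U; split.
  split=> //; rewrite UW; apply/funext => h; rewrite /= /U /W.
    by rewrite ZZ VTa TV.
  by rewrite ZTT ZZ TV TVa.
move=> i; rewrite UW; apply/funext => h; rewrite /= /U /W.
by rewrite -Za ZZ VTa -bT TV.
Qed.

Lemma spectral_cstar_extreme mu : spectral_measure mu -> cstar_extreme_point mu.
Proof.
move=> muS; have [muN _] := muS; split=> // n nu T nuN Ti TT muE.
have Tb i := (Ti i).1.
have H1 := spectral_intertwines muS nuN Tb muE.
have ex i : exists U, unitary_op U /\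
    forall A, measurable A -> nu i A = adj U \o mu A \o U.
  have sa' (m : set X -> H -> H) : normalized_povm m ->
      forall A : {A : set X | measurable A}, bounded_op (m (sval A)) /\ self_adjoint (m (sval A)).
    by move=> mN [A Am]; have [] := povm_psd mN.1 Am.
  have [|U [Uu UE]] := intertwining_polar (Tb i) (Ti i).2 (sa' _ muN) (sa' _ (nuN i)).
    by move=> [A Am] h; exact: H1.
  by exists U; split=> // A Am; exact: (UE (exist _ A Am)).
have [U UP] := choice ex; exists U; split=> i; first by have [] := UP i.
by have [_] := UP i.
Qed.

End PovmTheory.

(** * Atoms of extreme points *)
Section Atoms.
Context {R : realType} {d : measure_display} {X : measurableType d}
  {H : hilbertType R}.
Implicit Types (mu : set X -> H -> H) (A B : set X).

(** [Q] is the inverse square root of [S] and [T] the square root, obtained as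
    [S Q] so that a single square root is taken. *)
Lemma psd_factor (S : H -> H) (e : R) : psd S -> 0 < e ->
    (forall h, e * rdot h h <= rdot h (S h)) ->
  exists Q T, [/\ bounded_op Q /\ self_adjoint Q, bounded_op T /\ self_adjoint T,
    inverse_op T Q, (forall h, T (T h) = S h) & in_bicommutant S Q].
Proof.
move=> Sp e0 Se; have [Sb Ss _] := Sp.
have [G [Gp [SG GS]]] := inverse_of_lower_bound Sp e0 Se.
have [Q [Qb Qs Qc QQ]] := sqrt_op Gp.
have SQ h : S (Q h) = Q (S h) by apply: Qc => // k; rewrite SG GS.
exists Q, (fun h => S (Q h)); split=> //.
- by split; [exact: bounded_comp|move=> h k; rewrite Ss Qs -SQ].
- by split=> h; rewrite ?QQ ?SG// -SQ QQ SG.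
- by move=> h; rewrite -SQ QQ SG.
move=> B Bb BS; apply: Qc => // h.
by rewrite -[LHS]GS -BS SG.
Qed.

(** The two-valued measure by which [mu] is a multiple of [mu A] inside [A]. *)
Definition atom_weight mu A B : R := (~~ `[< mu (B `&` A) = 0 >])%:R.

Lemma atom_weightE mu A B h : atom mu A -> measurable B ->
  mu (B `&` A) h = (atom_weight mu A B)%:C *: mu A h.
Proof.
move=> [Am A0 Aat] Bm; rewrite /atom_weight.
case: asboolP => [->|BA] /=; first by rewrite scale0r.
rewrite scale1r; have [|//|->//] := Aat (B `&` A) _ (@subIsetr _ B A).
exact: measurableI.
Qed.

Lemma atom_weight1 mu A : atom mu A -> atom_weight mu A A = 1.
Proof.
by move=> [_ A0 _]; rewrite /atom_weight setIid; case: asboolP.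
Qed.

(** Countable additivity is read off from the scalar measure
    [B |-> inner h (mu (B `&` A) h)], where [inner h (mu A h)] is nonzero. *)
Lemma atom_weight_measure mu A (z : R[i]) : povm mu -> atom mu A ->
  complex_measure (fun B => (atom_weight mu A B)%:C * z).
Proof.
move=> muP Aat; have [Am A0 _] := Aat.
have [h h0] : exists h, mu A h != 0.
  apply: contrapT => a; apply: A0; apply/funext => h; apply: contrapT => /eqP ah.
  by apply: a; exists h.
have [Ab As Ap] := povm_psd muP Am.
have c0 : inner h (mu A h) != 0.
  apply: contra_neq h0 => e; apply: positive_null => //.
  by rewrite /rdot e.
have [_ _ muC] := muP.
have := complex_measureZ (c := (inner h (mu A h))^-1 * z)
  (complex_measure_restrict Am (muC h h)).
apply: complex_measure_eq => B Bm; rewrite (atom_weightE _ Aat Bm) innerZr.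
by rewrite mulrCA; congr (_ * _); rewrite mulrAC mulVf// mul1r.
Qed.

(** The value [mu A] of the atom is replaced by [D], the rest of the measure is
    halved, and [Q] is meant to normalize the total mass. *)
Definition reweighted mu A (D Q : H -> H) B h : H :=
  Q ((atom_weight mu A B)%:C *: D (Q h) + (2^-1)%:C *: mu (B `&` ~` A) (Q h)).

Lemma normalized_reweighted mu A D Q : normalized_povm mu -> atom mu A ->
  psd D -> bounded_op Q -> self_adjoint Q ->
  (forall h, Q (D (Q h) + (2^-1)%:C *: (Q h - mu A (Q h))) = h) ->
  normalized_povm (reweighted mu A D Q).
Proof.
move=> muN Aat [Db Ds Dp] Qb Qs Q1; have [muP mu1] := muN.
have [Am A0 _] := Aat; have Acm := measurableC Am.
have Bp B : measurable B -> psd (mu (B `&` ~` A)).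
  by move=> Bm; apply: povm_psd => //; exact: measurableI.
have rb B : measurable B -> bounded_op (reweighted mu A D Q B).
  move=> Bm; apply: bounded_comp => //; apply: bounded_add; apply: bounded_scale.
    exact: bounded_comp.
  by apply: bounded_comp => //; have [] := Bp B Bm.
split.
  split=> // [B Bm|h k].
    apply/(positive_opP (rb B Bm)); have [Mb Ms Mp] := Bp B Bm; split=> [h k|h].
      by rewrite /reweighted Qs [RHS]rdotC Qs [RHS]rdotC !rdotE Ds Ms.
    rewrite /reweighted Qs !rdotE; apply: addr_ge0; exact: mulr_ge0.
  have [_ _ muC] := muP.
  have c1 := atom_weight_measure (z := inner (Q h) (D (Q k))) muP Aat.
  have c2 := complex_measureZ (c := (2^-1)%:C)
    (complex_measure_restrict Acm (muC (Q h) (Q k))).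
  apply: complex_measure_eq (complex_measureD c1 c2) => B Bm.
  rewrite /reweighted (is_adjointP Qb Qs) innerDr !innerZr//.
apply/funext => h; rewrite /reweighted setTI povmC// -[RHS]Q1; congr (Q (_ + _)).
rewrite /atom_weight setTI; case: asboolP => // _.
by rewrite scale1r.
Qed.

(** The decomposition of [mu] has the two terms obtained from [D] and
    [mu A - D], each normalized by the inverse square root of its total mass. *)
Lemma atom_exchange mu A D (e : R) : cstar_extreme_point mu -> atom mu A ->
  psd D -> 0 < e ->
  (forall h, rdot h (D h) <= rdot h (mu A h)) ->
  (forall h, e * rdot h h <= rdot h (D h + (2^-1)%:C *: (h - mu A h))) ->
  (forall h, e * rdot h h <=
     rdot h (mu A h - D h + (2^-1)%:C *: (h - mu A h))) ->
  exists Q U, [/\ bounded_op Q /\ self_adjoint Q,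
    in_bicommutant (fun h => D h + (2^-1)%:C *: (h - mu A h)) Q,
    (forall h, Q (D (Q h) + (2^-1)%:C *: (Q h - mu A (Q h))) = h), unitary_op U &
    forall h, Q (D (Q h)) = adj U (mu A (U h))].
Proof.
move=> [muN muX] Aat Dp e0 Dle S1e S2e; have [muP mu1] := muN.
have [Am A0 _] := Aat; have [ab as_ ap] := povm_psd muP Am.
have [Db Ds D0] := Dp.
pose D' (i : 'I_2) h := if i == 0 then D h else mu A h - D h.
have D'p i : psd (D' i).
  rewrite /D'; case: eqP => _ //; split; first exact: bounded_sub.
    by move=> h k; rewrite !rdotE as_ Ds.
  by move=> h; rewrite rdotDr rdotNr subr_ge0.
pose S i h := D' i h + (2^-1)%:C *: (h - mu A h).
have Se i h : e * rdot h h <= rdot h (S i h).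
  by rewrite /S /D'; case: eqP.
have Sp i : psd (S i).
  have [D'b D's D'0] := D'p i; split.
  - by apply: bounded_add => //; apply: bounded_scale; exact: bounded_sub bounded_id ab.
  - by move=> h k; rewrite !rdotE D's as_.
  - by move=> h; apply: le_trans (Se i h); rewrite mulr_ge0 ?rdotxx_ge0 ?ltW.
have /choice[Q /choice[T QT]] := fun i => psd_factor (Sp i) e0 (Se i).
have Qb i : bounded_op (Q i) by have [[]] := QT i.
have Qs i : self_adjoint (Q i) by have [[]] := QT i.
have Tb i : bounded_op (T i) by have [_ []] := QT i.
have Ts i : self_adjoint (T i) by have [_ []] := QT i.
have TQ i h : T i (Q i h) = h by have [_ _ []] := QT i.
have QTK i h : Q i (T i h) = h by have [_ _ []] := QT i.
have TT i h : T i (T i h) = S i h by have [] := QT i.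
have Q1 i h : Q i (D' i (Q i h) + (2^-1)%:C *: (Q i h - mu A (Q i h))) = h.
  by rewrite -/(S i (Q i h)) -TT TQ QTK.
have [| | | |U [Uu UE]] := muX 2%N (fun i => reweighted mu A (D' i) (Q i)) T.
- by move=> i; exact: normalized_reweighted.
- move=> i; split=> //; exists (Q i); split=> //; apply/funext => h /=; rewrite ?TQ//.
- apply/funext => h; rewrite fct_sumE !big_ord_recl big_ord0 /=.
  rewrite !(adj_self (Tb _) (Ts _)) !TT /S /D'/=; apply: rdot_inj => k.
  by rewrite addr0 !rdotE; lra.
- move=> B Bm; apply/funext => h; rewrite fct_sumE !big_ord_recl big_ord0 /=.
  rewrite !(adj_self (Tb _) (Ts _)) /reweighted !QTK !TQ /D'/=.
  rewrite (povm_split h muP Am Bm) (atom_weightE _ Aat Bm).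
  by apply: rdot_inj => k; rewrite addr0 !rdotE; lra.
have D'0 : D' ord0 = D by [].
have := Q1 ord0; have := UE ord0 A Am; have := QT ord0.
rewrite /S D'0 => -[_ _ _ _ Qc] UA Q1'; exists (Q ord0), (U ord0); split=> // h.
have /= <- := congr1 (@^~ h) UA.
by rewrite /reweighted (atom_weight1 Aat) scale1r setICr povm0// scaler0 addr0.
Qed.

(** With [D] half a spectral projection [P] of [a = mu A], the operator
    [Q D Q] has a gap in its spectrum next to [0], and [a] inherits it by unitary
    equivalence. *)
Lemma atom_projection_near mu A (eta : R) : cstar_extreme_point mu ->
  atom mu A -> 0 < eta -> eta <= 2^-1 ->
  forall h, rdot h (mu A h) <= (1 + eta) * rdot (mu A h) (mu A h).
Proof.
move=> muX Aat eta0 eta1; have [muN _] := muX; have [muP mu1] := muN.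
have [Am A0 _] := Aat; have [ab as_ ap] := povm_psd muP Am.
have a1 h := povm_le1 h muN Am.
set a := mu A in ab as_ ap a1 *.
have [P [Pb Ps PP Pc [Pge Ple]]] := spectral_projection (1 - eta) ab as_.
have Pa h : P (a h) = a (P h) by rewrite (Pc a ab).
have pg h k : rdot (P h) (k - P k) = 0.
  by rewrite -Ps (bopD Pb) (bopN Pb) PP subrr rdot0r.
have split1 h : rdot h h = rdot (P h) (P h) + rdot (h - P h) (h - P h).
  transitivity (rdot (P h + (h - P h)) (P h + (h - P h))); first by rewrite addrC subrK.
  have := pg h h; move: (h - P h) => g e.
  by rewrite rdotDl !rdotDr e (rdotC g) e addr0 add0r.
have splita h : rdot h (a h) =
    rdot (P h) (a (P h)) + rdot (h - P h) (a (h - P h)).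
  transitivity (rdot (P h + (h - P h)) (a (P h + (h - P h)))); first by rewrite addrC subrK.
  have e1 : rdot (P h) (a (h - P h)) = 0 by rewrite (bopD ab) (bopN ab) -Pa pg.
  have e2 : rdot (h - P h) (a (P h)) = 0 by rewrite -Pa rdotC pg.
  move: (h - P h) e1 e2 => g e1 e2.
  by rewrite (bopD ab) rdotDl !rdotDr e1 e2 addr0 add0r.
have hP h : rdot h (P h) = rdot (P h) (P h) by rewrite -[in LHS]PP Ps.
pose D h := (2^-1)%:C *: P h.
have Dp : psd D.
  split; first exact: bounded_scale.
    by move=> h k; rewrite !rdotE Ps.
  by move=> h; rewrite rdotZr hP mulr_ge0 ?rdotxx_ge0// invr_ge0.
have facts h : [/\ (1 - eta) * rdot (P h) (P h) <= rdot (P h) (a (P h)),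
    rdot (P h) (a (P h)) <= rdot (P h) (P h),
    0 <= rdot (h - P h) (a (h - P h)) <= (1 - eta) * rdot (h - P h) (h - P h),
    eta * rdot (P h) (P h) <= 2^-1 * rdot (P h) (P h) &
    eta * rdot (h - P h) (h - P h) <= 2^-1 * rdot (h - P h) (h - P h)].
  by split=> //; rewrite ?ap ?Ple// ler_wpM2r ?rdotxx_ge0.
(* The total mass [(P + 1 - a) / 2] is at least [eta / 2] off the range of [P],
   where [1 - a >= eta], and at least [1 / 2] on it; the complementary mass
   [(1 + a - P) / 2] is at least [1 / 4], as [a >= 1 / 2] on the range of [P]. *)
have e0 : 0 < eta / 2 by rewrite divr_gt0.
have [|||Q [U [[Qb Qs] Qc Q1 [Ub UU' U'U] QDQ]]] := atom_exchange muX Aat Dp e0.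
- move=> h; rewrite /D rdotZr hP -/a splita.
  by have [] := facts h; have := rdotxx_ge0 (P h); lra.
- move=> h; rewrite -/a /D rdotDr !rdotZr rdotDr rdotNr hP splita split1.
  have [] := facts h; have := rdotxx_ge0 (P h); have := rdotxx_ge0 (h - P h). lra.
- move=> h; rewrite -/a /D !rdotDr !rdotNr !rdotZr rdotDr rdotNr hP splita split1.
  have [] := facts h; have := rdotxx_ge0 (P h); have := rdotxx_ge0 (h - P h). lra.
have QP h : P (Q h) = Q (P h).
  apply: Qc => // k; rewrite /D (bopD Pb) !(bopZ Pb) (bopD Pb) (bopN Pb) -/a Pa.
  by [].
pose S k := D k + (2^-1)%:C *: (k - a k).
have Sb : bounded_op S.
  apply: bounded_add; first by have [] := Dp.
  by apply: bounded_scale; exact: bounded_sub bounded_id ab.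
have SQQ k : S (Q (Q k)) = k by rewrite [LHS](Qc S Sb)//; exact: Q1.
have QDQE h : Q (D (Q h)) = (2^-1)%:C *: P (Q (Q h)) by rewrite /D (bopZ Qb) -QP.
(* On the range of [P] the mass [S] is at most [(1 + eta) / 2], so that
   [Q D Q = S^-1 P / 2] is close to a projection. *)
have near h : rdot h (Q (D (Q h))) <= (1 + eta) * rdot (Q (D (Q h))) (Q (D (Q h))).
  rewrite QDQE; set g := Q (Q h).
  have hE : h = S g by rewrite SQQ.
  rewrite [X in rdot X _ <= _]hE.
  have e1 : rdot (a g) (P g) = rdot (P g) (a (P g)).
    by rewrite -[in LHS]PP Ps Pa rdotC.
  rewrite /S /D !rdotE e1 hP; have [] := facts g; lra.
have isoU h k : rdot (adj U h) (adj U k) = rdot h k.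
  rewrite -(is_adjoint_rdot _ _ (adjP Ub)).
  by have /= -> := congr1 (@^~ k) U'U.
move=> h; have := near (adj U h); rewrite QDQ !isoU.
by have /= -> := congr1 (@^~ h) U'U.
Qed.

(** Letting [eta] tend to [0] above gives [a <= a ^ 2]; the converse holds for
    every [0 <= a <= 1]. *)
Lemma atom_projection mu A : cstar_extreme_point mu -> atom mu A ->
  projection (mu A).
Proof.
move=> muX Aat; have [muN _] := muX; have [muP mu1] := muN.
have [Am _ _] := Aat; have [ab as_ ap] := povm_psd muP Am.
have a1 h := povm_le1 h muN Am; apply/projectionP => // h.
have aa_le k : rdot (mu A k) (mu A k) <= rdot k (mu A k).
  by rewrite -[leRHS]mul1r; apply: positive_sqr_le => // l; rewrite mul1r.
have aa_ge k : rdot k (mu A k) <= rdot (mu A k) (mu A k).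
  rewrite leNgt; apply/negP => lt.
  set s := rdot k (mu A k) in lt; set t := rdot (mu A k) (mu A k) in lt.
  have t0 : 0 <= t by rewrite rdotxx_ge0.
  pose eta := Num.min 2^-1 ((s - t) / (2 * (t + 1))).
  have t1 : 0 < 2 * (t + 1) by lra.
  have eta0 : 0 < eta by rewrite lt_min invr_gt0 ltr0n divr_gt0 ?subr_gt0.
  have eta1 : eta <= 2^-1 by rewrite ge_min lexx.
  have := atom_projection_near muX Aat eta0 eta1 k; rewrite -/s -/t.
  have : eta * (2 * (t + 1)) <= s - t by rewrite -ler_pdivlMr// ge_min lexx orbT.
  nra.
pose B k := mu A k - mu A (mu A k).
have Bb : bounded_op B by apply: bounded_sub => //; exact: bounded_comp.
have Bs : self_adjoint B by move=> k l; rewrite !rdotE !as_.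
apply/esym/eqP; rewrite -subr_eq0; apply/eqP.
apply: (positive_null (T := B)) => //.
  by move=> k; rewrite rdotDr rdotNr (as_ k (mu A k)) subr_ge0.
by rewrite rdotDr rdotNr (as_ h (mu A h)) subr_le0.
Qed.

End Atoms.

(** * Exhaustion by sets on which the measure is projection valued *)
Section Exhaustion.
Context {R : realType} {d : measure_display} {X : measurableType d}
  {H : hilbertType R}.
Variables (mu : set X -> H -> H) (muN : normalized_povm mu).
Implicit Types (A B C E : set X).

Let muP : povm mu := muN.1.

Definition idempotent_at E := forall h, mu E (mu E h) = mu E h.

(** Quantifying over all measurable subsets makes the property hereditary, which
    is what allows countable unions to be disjointified. *)
Definition projective_on C := measurable C /\
  forall E, measurable E -> E `<=` C -> idempotent_at E.

(** Two projections with sum at most [1] are orthogonal. *)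
Lemma idempotent_atU A B : measurable A -> measurable B -> A `&` B = set0 ->
  idempotent_at A -> idempotent_at B -> idempotent_at (A `|` B).
Proof.
have cross A' B' : measurable A' -> measurable B' -> A' `&` B' = set0 ->
    idempotent_at A' -> forall h, mu B' (mu A' h) = 0.
  move=> Am Bm AB Ai h; have [Bb Bs Bp] := povm_psd muP Bm.
  apply: positive_null => //.
  have := povm_le1 (mu A' h) muN (measurableU _ _ Am Bm).
  by rewrite povmU// Ai rdotDr; lra.
move=> Am Bm AB Ai Bi h; have [Ab _ _] := povm_psd muP Am.
have [Bb _ _] := povm_psd muP Bm.
rewrite !povmU// (bopD Ab) (bopD Bb) Ai Bi (cross A B)// (cross B A) ?addr0 ?add0r//.
by rewrite setIC.
Qed.

(** The partial unions give increasing projections [mu (U n)] below [mu E], so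
    [mu E \o mu (U n) = mu (U n)]; the weak limit of this identity is
    [mu E \o mu E = mu E]. *)
Lemma projective_on_bigcup (C : nat -> set X) :
  (forall n, projective_on (C n)) -> projective_on (\bigcup_n C n).
Proof.
move=> Cp; have Cm n := (Cp n).1; split; first exact: bigcupT_measurable.
move=> E Em EC; pose F n := E `&` seqDU C n.
have Dm n : measurable (seqDU C n).
  by apply: measurableD => //; apply: bigsetU_measurable.
have Fm n : measurable (F n) by exact: measurableI.
have Ft : trivIset setT F.
  by apply: trivIset_setIl; exact: trivIset_seqDU.
have EF : \bigcup_n F n = E.
  by rewrite -setI_bigcupr -seqDU_bigcup_eq; apply/setIidPl.
have Fi n : idempotent_at (F n).
  by apply: (Cp n).2 => //; move=> x [_ Dx]; exact: subset_seqDU Dx.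
pose U n := \big[setU/set0]_(i < n) F i.
have Um n : measurable (U n) by apply: bigsetU_measurable.
have US n : U n.+1 = U n `|` F n by rewrite /U big_ord_recr.
have UF n : U n `&` F n = set0.
  rewrite /U -(bigcup_mkord n F) -subset0 => x [[i /= ilt Fix] Fnx].
  have /trivIsetP/(_ i n I I) := Ft; rewrite neq_ltn ilt => /(_ isT) e.
  by suff : (F i `&` F n) x by rewrite e.
have U0 h : mu (U 0%N) h = 0 by rewrite /U big_ord0 povm0.
have Ui n : idempotent_at (U n).
  elim: n => [|n IH]; first by move=> h; rewrite !U0.
  by rewrite US; apply: idempotent_atU.
have UE n : U n `<=` E.
  by rewrite /U -(bigcup_mkord n F) => x [i _ []].
have [Eb Es Ep] := povm_psd muP Em.
have EU n h : mu E (mu (U n) h) = mu (U n) h.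
  have Ec := measurableC Em; have [cb cs cp] := povm_psd muP Ec.
  apply/esym/eqP; rewrite -subr_eq0 -povmC//; apply/eqP/positive_null => //.
  rewrite povmC// rdotDr rdotNr subr_le0.
  apply: le_trans (povm_le _ muP (Um n) Em (UE n)).
  by rewrite Ui.
have UU n k : mu (U n) k = \sum_(0 <= i < n) mu (F i) k.
  elim: n => [|n IH]; first by rewrite U0 big_nil.
  by rewrite US povmU// big_nat_recr//= IH.
have Ucvg h k : (fun n => inner h (mu (U n) k)) @ \oo --> (inner h (mu E k) : R[i]^o).
  have [_ _ muC] := muP; have := muC h k F Fm Ft; rewrite EF.
  rewrite (_ : (fun n => _) = (fun n => inner h (mu (U n) k)))//.
  apply/funext => n; rewrite UU.
  elim: n => [|n IH]; first by rewrite !big_nil /inner linear0l.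
  by rewrite !big_nat_recr//= IH innerDr.
move=> k; apply: rdot_inj => h; rewrite /rdot; congr complex.Re.
have Ea := is_adjointP Eb Es; rewrite Ea.
have c1 := Ucvg (mu E h) k; have c2 := Ucvg h k.
rewrite (_ : (fun n => inner (mu E h) (mu (U n) k)) =
  (fun n => inner h (mu (U n) k))) in c1.
  exact: (cvg_unique (@norm_hausdorff _ R[i]^o) c1 c2).
by apply/funext => n; rewrite -Ea EU.
Qed.

Lemma projective_onU A B : projective_on A -> projective_on B ->
  projective_on (A `|` B).
Proof.
move=> Ap Bp; rewrite -bigcup2E; apply: projective_on_bigcup => -[|[|n]]//=.
split=> // E Em; rewrite subset0 => -> h; by rewrite !povm0.
Qed.

(** A maximizing sequence is replaced by its union. *)
Lemma projective_on_sup h : exists C, projective_on C /\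
  forall B, projective_on B -> rdot h (mu B h) <= rdot h (mu C h).
Proof.
pose f C := rdot h (mu C h); pose V := f @` projective_on.
have Vs : has_sup V.
  split.
    exists (f set0), set0 => //; split=> // E Em; rewrite subset0 => -> k.
    by rewrite !povm0.
  by exists (rdot h h) => _ [C [Cm _] <-]; exact: povm_le1.
have /choice[C CP] : forall n : nat, exists C,
    projective_on C /\ sup V - n.+1%:R^-1 < f C.
  move=> n; have [|_ [C Cp <-] ?] := @sup_adherent _ V n.+1%:R^-1 _ Vs.
    by rewrite invr_gt0.
  by exists C.
have CU : projective_on (\bigcup_n C n).
  by apply: projective_on_bigcup => n; have [] := CP n.
exists (\bigcup_n C n); split=> // B Bp.
have fB : f B <= sup V by apply: ub_le_sup; [exact: Vs.2|exists B].
apply: (le_trans fB); apply/ler_addgt0Pr => e e0.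
have [n _ ne] := near_infty_natSinv_lt (PosNum e0).
have ne' : n.+1%:R^-1 < e := ne n (leqnn n).
have [[Cm _] Cn] := CP n.
have CnU : f (C n) <= rdot h (mu (\bigcup_n C n) h).
  by apply: povm_le => //; [exact: CU.1|exact: bigcup_sup].
move: (sup V) (n.+1%:R^-1 : R) (f (C n)) (rdot _ _) Cn ne' CnU => s t u v; lra.
Qed.

(** Separability makes countably many test vectors sufficient: a set that is
    maximal for each of them leaves no room for a further projection. *)
Lemma projective_on_exhaustion : separable_space H -> exists C, projective_on C /\
  forall A, projective_on A -> A `&` C = set0 -> mu A = 0.
Proof.
move=> [D [/pfcard_geP Dc Dd]].
have [u uD] : exists u : nat -> H, D `<=` range u.
  case: Dc => [->|[u]]; first by exists (fun=> 0) => x [].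
  by exists u => x Dx; have [n _ <-] := 'surj_u Dx; exists n.
have [C CP] := choice (fun n => projective_on_sup (u n)).
exists (\bigcup_n C n); split.
  by apply: projective_on_bigcup => n; have [] := CP n.
move=> A Ap AC; have Am := Ap.1; have [Ab As A0] := povm_psd muP Am.
have Au n : mu A (u n) = 0.
  have [Cp Cmax] := CP n; apply: positive_null => //.
  have := Cmax _ (projective_onU Cp Ap); rewrite povmU//; last first.
    + rewrite -subset0 => x [Cx Ax]; rewrite -AC; split=> //; by exists n.
    + exact: Cp.1.
  by rewrite rdotDr gerDl.
apply/funext => h; apply: rnorm0_eq0; apply/eqP; rewrite eq_le rnorm_ge0 andbT.
apply/ler_addgt0Pr => e e0; rewrite add0r.
have [M M0 AM] := bop_bound Ab.
have eM : 0 < e / M by rewrite divr_gt0.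
have [|x [xb Dx]] := Dd (ball h (e / M)%:C) _ (ball_open _ _).
  by exists h; apply: ballxx; rewrite ltcR.
have [n _ un] := uD _ Dx.
have : rnorm (h - x) < e / M by move: xb; rewrite -ball_normE /= normE ltcR.
rewrite ltr_pdivlMr// => hx; have -> : mu A h = mu A (h - x).
  by rewrite (bopD Ab) (bopN Ab) -un Au subr0.
by apply: le_trans (AM _) _; rewrite mulrC ltW.
Qed.

End Exhaustion.

(** * Atomic measures *)

Section AtomicMeasures.
Context {R : realType} {d : measure_display} {X : measurableType d}
  {H : hilbertType R}.
Implicit Types (mu : set X -> H -> H).

Lemma atom_projective_on mu A : normalized_povm mu -> atom mu A ->
  projection (mu A) -> projective_on mu A.
Proof.
move=> muN [Am A0 Aat] /(projectionP muN.1 Am) Ai; split=> // E Em EA h.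
by have [->|->] := Aat E Em EA.
Qed.

Lemma cstar_extreme_atomic_spectral mu : separable_space H -> atomic mu ->
  cstar_extreme_point mu -> spectral_measure mu.
Proof.
move=> Hs muA muX; have [muN _] := muX; have muP := muN.1.
have [C [Cp Cmax]] := projective_on_exhaustion muN Hs.
have Cm := Cp.1; have Ccm := measurableC Cm.
have C0 : mu (~` C) = 0.
  apply: contrapT => /(muA _ Ccm)[A AC Aat]; have [_ A0 _] := Aat; apply: A0.
  apply: Cmax; first exact/atom_projective_on/atom_projection.
  by rewrite -subset0 => x [/AC].
split=> // A Am; apply/projectionP => // h.
have AE k : mu A k = mu (A `&` C) k.
  have e : mu (A `&` ~` C) = 0.
    by apply: (povm_null_sub muP _ Ccm _ C0) => //; exact: measurableI.
  by rewrite (povm_split k muP Cm Am) e addr0.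
by rewrite !AE; apply: Cp.2 => //; exact: measurableI.
Qed.

(** A non-null set contains a non-null point, by countable additivity over its
    points, and a point is an atom as soon as it is non-null. *)
Lemma countable_atomic mu : (forall x : X, measurable [set x]) ->
  countable [set: X] -> povm mu -> atomic mu.
Proof.
move=> X1 /countable_injP[f f_inj] muP A Am A0.
have [x Ax mux] : exists2 x, A x & mu [set x] <> 0.
  apply: contrapT => nx; apply: A0.
  have mu1 x : A x -> mu [set x] = 0.
    by move=> Ax; apply: contrapT => ?; apply: nx; exists x.
  pose F n := A `&` f @^-1` [set n].
  have FE n : F n = set0 \/ exists2 x, A x & F n = [set x].
    have [[x [Ax fx]]|nF] := pselect (F n !=set0); last first.
      by left; apply: contrapT => /eqP/set0P.
    right; exists x => //; apply/seteqP; split=> [y [Ay fy]|_ ->//].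
    by apply: f_inj; rewrite ?inE//= fx fy.
  have Fm n : measurable (F n) by have [->|[x _ ->]] := FE n.
  have F0 n : mu (F n) = 0.
    have [->|[x Ax ->]] := FE n; last exact: mu1.
    by apply/funext => h; rewrite povm0.
  have Ft : trivIset setT F by move=> i j _ _ [x [[_ <-] [_ <-]]].
  have FA : \bigcup_n F n = A.
    by apply/seteqP; split=> [x [n _ []//]|x Ax]; exists (f x).
  apply/funext => k; apply: rdot_inj => h; rewrite rdot0r /rdot.
  have [_ _ muC] := muP; have := muC h k F Fm Ft; rewrite FA.
  rewrite (_ : (fun n => _) = (fun=> 0)).
    move=> c; have c0 : (fun _ : nat => 0 : R[i]^o) @ \oo --> (0 : R[i]^o).
      by apply: (@cvg_cst R[i]^o).
    by have -> := cvg_unique (@norm_hausdorff _ R[i]^o) c c0.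
  apply/funext => n; apply: big1 => i _; rewrite F0.
  by rewrite /inner linear0l.
exists [set x]; first by move=> _ ->.
split=> // B Bm /subset_set1[->|->]; last by right.
by left; apply/funext => h; rewrite povm0.
Qed.

End AtomicMeasures.

Theorem theorem3p11 (R : realType) (d : measure_display) (X : measurableType d)
    (X_set1 : forall x : X, measurable [set x])
    (H : hilbertType R) (H_separable : separable_space H) :
  (forall mu : set X -> H -> H, normalized_povm mu -> atomic mu ->
     (cstar_extreme_point mu <-> spectral_measure mu)) /\
  (countable [set: X] ->
     forall mu : set X -> H -> H,
       cstar_extreme_point mu -> spectral_measure mu).
Proof.
split=> [mu muN muA|Xc mu muX].
  split; first exact: cstar_extreme_atomic_spectral.
  exact: spectral_cstar_extreme.
apply: cstar_extreme_atomic_spectral => //.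
by apply: countable_atomic => //; exact: muX.1.1.
Qed.
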